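(* Let $g:\mathbb{S}^2_-\to\mathbb{S}^2_+$ be a smooth strictly length decreasing map, i.e. $|dg(w)|<|w|$ for every nonzero tangent vector $w$. For $x\in\mathbb{S}^2_-$ the 2-vector $x+g(x)\in\Lambda^2(\mathbb{R}^4)$ is a simple unit 2-vector and thus determines an oriented 2-plane $P(x)\subset\mathbb{R}^4$. Then the great circles $P(x)\cap\mathbb{S}^3$, $x\in\mathbb{S}^2_-$, are pairwise disjoint and cover $\mathbb{S}^3$; the unit vector field $\zeta$ tangent to them (oriented by the orientation of $P(x)$) is smooth on $\mathbb{S}^3$; and the map $\mathbb{S}^3\to\mathbb{S}^2_-$ sending $p$ to the unique $x$ with $p\in P(x)$ is a smooth submersion with totally geodesic fibers. Moreover, $\zeta$ is a Hopf vector field (equivalently this submersion is a Hopf fibration) if and only if $g$ is constant.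
   Context: $\mathbb{R}^4$ has orthonormal basis $(\varepsilon_1,\dots,\varepsilon_4)$. $\Lambda^2(\mathbb{R}^4)$ carries the inner product $(v_1\wedge v_2,w_1\wedge w_2)=\langle v_1,w_1\rangle\langle v_2,w_2\rangle-\langle v_1,w_2\rangle\langle v_2,w_1\rangle$. The Hodge star $*$ is the linear involution with $*(\varepsilon_1\wedge\varepsilon_2)=\varepsilon_3\wedge\varepsilon_4$, $*(\varepsilon_1\wedge\varepsilon_3)=-\varepsilon_2\wedge\varepsilon_4$, $*(\varepsilon_1\wedge\varepsilon_4)=\varepsilon_2\wedge\varepsilon_3$. $E_\pm=\{\omega:*\omega=\pm\omega\}$, $\mathbb{S}^2_\pm=\{\omega\in E_\pm:\|\omega\|=1/\sqrt2\}$ with the metrics induced from $\Lambda^2(\mathbb{R}^4)$. A simple unit 2-vector $v_1\wedge v_2$ ($v_1,v_2$ orthonormal) determines the oriented plane spanned by $(v_1,v_2)$. A Hopf vector field on $\mathbb{S}^3$ is one of the form $\zeta(p)=\mathcal{J}p$ with $\mathcal{J}\in O(4)$, $\mathcal{J}^2=-I$; a Hopf fibration is a submersion $\mathbb{S}^3\to\mathbb{S}^2$ whose fibers are the integral curves of a Hopf vector field. *)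

(* Defs.v *)
From HB Require Import structures.
From mathcomp Require Import all_boot all_order all_algebra.
From mathcomp Require Import all_classical all_reals all_analysis.
Set Implicit Arguments. Unset Strict Implicit. Unset Printing Implicit Defensive.
Import Order.TTheory GRing.Theory Num.Theory.
Import numFieldNormedType.Exports.
Local Open Scope classical_set_scope.
Local Open Scope ring_scope.

Section Defs.
Variable R : realType.

Definition dotv n (u v : 'rV[R]_n) : R := \sum_(i < n) u 0 i * v 0 i.

(* Lambda^2(R^4) is identified with R^6 via the orthonormal basis
   e1^e2, e1^e3, e1^e4, e2^e3, e2^e4, e3^e4 (indices 0..5);
   the inner product of the context is then dotv. *)
Definition pi1 (k : 'I_6) : 'I_4 := inord (nth 0%N [:: 0; 0; 0; 1; 1; 2]%N k).
Definition pi2 (k : 'I_6) : 'I_4 := inord (nth 0%N [:: 1; 2; 3; 2; 3; 3]%N k).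

Definition wedge (v w : 'rV[R]_4) : 'rV[R]_6 :=
  \row_k (v 0 (pi1 k) * w 0 (pi2 k) - v 0 (pi2 k) * w 0 (pi1 k)).

(* Hodge star: *e12 = e34, *e13 = -e24, *e14 = e23 (and involutive). *)
Definition hsign (k : 'I_6) : R := if (val k == 1%N) || (val k == 4%N) then -1 else 1.
Definition hodge (w : 'rV[R]_6) : 'rV[R]_6 := \row_k (hsign k * w 0 (rev_ord k)).

Definition Eplus : set 'rV[R]_6 := [set w | hodge w = w].
Definition Eminus : set 'rV[R]_6 := [set w | hodge w = - w].
Definition S2plus : set 'rV[R]_6 := [set w | Eplus w /\ dotv w w = 1 / 2].
Definition S2minus : set 'rV[R]_6 := [set w | Eminus w /\ dotv w w = 1 / 2].
Definition S3 : set 'rV[R]_4 := [set p | dotv p p = 1].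

Definition orthonormal2 (v1 v2 : 'rV[R]_4) :=
  dotv v1 v1 = 1 /\ dotv v2 v2 = 1 /\ dotv v1 v2 = 0.

Definition simple_unit (om : 'rV[R]_6) :=
  exists v1 v2, orthonormal2 v1 v2 /\ wedge v1 v2 = om.

Definition plane_mem (om : 'rV[R]_6) (p : 'rV[R]_4) :=
  exists v1 v2, orthonormal2 v1 v2 /\ wedge v1 v2 = om /\
    exists a b : R, p = a *: v1 + b *: v2.

Fixpoint Ck {m n : nat} (k : nat) (f : 'rV[R]_m.+1 -> 'rV[R]_n.+1)
    (U : set 'rV[R]_m.+1) : Prop :=
  match k with
  | O => forall x, U x -> {for x, continuous f}
  | S k' => (forall x, U x -> {for x, continuous f}) /\
            (forall x v, U x -> derivable f x v) /\
            (forall v, Ck k' (fun x => derive f x v) U)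
  end.

Definition smooth_on {m n : nat} (f : 'rV[R]_m.+1 -> 'rV[R]_n.+1)
    (U : set 'rV[R]_m.+1) := open U /\ forall k, Ck k f U.

(* Hopf vector field: zeta p = J p with J orthogonal, J^2 = -I
   (row-vector convention: J p is written p *m J). *)
Definition hopf_field (zeta : 'rV[R]_4 -> 'rV[R]_4) :=
  exists J : 'M[R]_4, J^T *m J = 1%:M /\ J *m J = - 1%:M /\
    forall p, S3 p -> zeta p = p *m J.

End Defs.

(* Main.v *)
(** Write a point p of S^3 as a unit quaternion and identify S^2_- and S^2_+ with the unit
  sphere of imaginary quaternions.  Then p lies in the plane of the two-vector x + y exactly
  when p x = y p, i.e. when x = conj(p) y p, so the planes P(x) through p correspond to the fixed
  points of the map x |-> conj(p) g(x) p of the sphere.  Since g strictly decreases lengths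
  and the sphere is compact, |dg| <= l < 1, and comparing images of great circle arcs with
  arcsin shows that g, hence each of these maps, contracts chordal distances by a uniform
  factor mu < 1: the fixed point pi(p) exists, is unique and is Lipschitz in p.
  Differentiating pi = conj(p) g(pi) p gives d pi in terms of pi, as I - conj(p) dg p is
  invertible, so pi is smooth by bootstrapping; it is a submersion because
  p |-> conj(p) b p is one.  The field is zeta(p) = p pi(p) = g(pi(p)) p.  A complex structure
  J in O(4) is left or right multiplication by an imaginary unit b or a; in the first case
  g = b, in the second pi would be constant. *)
Require Import Defs.
From HB Require Import structures.
From mathcomp Require Import all_boot all_order all_algebra.
From mathcomp Require Import all_classical all_reals all_analysis.
From mathcomp Require Import ring lra.
Import Order.TTheory GRing.Theory Num.Theory.
Import numFieldNormedType.Exports.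
Local Open Scope classical_set_scope.
Local Open Scope ring_scope.
Set Implicit Arguments. Unset Strict Implicit. Unset Printing Implicit Defensive.

(** * Smooth functions of several variables *)

(** Three obstacles shape the proof. Smoothness is phrased by iterated directional derivatives,
    which are not linear in the direction by definition, so linearity and Fréchet differentiability
    of C^1 functions are derived before any chain rule. The bound on dg concerns only vectors
    tangent to the sphere, while the calculus runs in open sets of R^n. The map g is therefore
    precomposed with a polynomial map fixing the sphere whose differential there kills the normal
    direction; after this the strict bound holds for all nonzero ambient vectors and ambient
    matrices replace tangent maps. The vector field and the projection must be smooth on an open
    neighbourhood of S^3, so the fixed point problem is posed for every p != 0, with the conjugation
    normalized to stay a rotation. For the submersion, d pi (I - dg Q) is the differential of p |->
    conj(p) b p with b = g(pi(p)) frozen. To reach a tangent vector w it thus suffices that this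
    simpler map reaches w (I - dg Q), which is again tangent. *)

Section SmoothCalculus.
Variable R : realType.

(** Real values allow products, quotients and determinants; an arbitrary normed domain covers the
    pairs (x, w) of the compactness argument. [Ck_Cs] translates to the vector-valued [Ck]. *)
Fixpoint Cs (V : normedModType R) (k : nat) (f : V -> R) (U : set V) : Prop :=
  match k with
  | O => forall x, U x -> {for x, continuous f}
  | S k' => (forall x, U x -> {for x, continuous f}) /\
            (forall x v, U x -> derivable f x v) /\
            (forall v, Cs k' (fun x => 'D_v f x) U)
  end.

Section Generic.
Variable V : normedModType R.
Implicit Types (f g : V -> R) (U : set V).

Lemma Cs_continuous k f U x : Cs k f U -> U x -> {for x, continuous f}.
Proof. by case: k => [cf|k [cf _]]; exact: cf. Qed.

Lemma Cs_derivable k f U x v : Cs k.+1 f U -> U x -> derivable f x v.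
Proof. by move=> [_ [df _]]; exact: df. Qed.

Lemma Cs_derive k f U v : Cs k.+1 f U -> Cs k ('D_v f) U.
Proof. by move=> [_ [_ df]]; exact: df. Qed.

Lemma eq_on_near f g U x : open U -> {in U, f =1 g} -> U x -> {near x, f =1 g}.
Proof.
move=> oU fg Ux; have := open_nbhs_nbhs (conj oU Ux).
by apply: filterS => y Uy; apply: fg; rewrite inE.
Qed.

Lemma continuous_ext_on f g U x : open U -> {in U, f =1 g} -> U x ->
  {for x, continuous f} -> {for x, continuous g}.
Proof.
move=> oU fg Ux; rewrite /prop_for /continuous_at -(fg x) ?inE// => h.
by apply: cvg_trans h; exact/near_eq_cvg/(eq_on_near oU fg Ux).
Qed.

Lemma Cs_ext k f g U : open U -> {in U, f =1 g} -> Cs k f U -> Cs k g U.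
Proof.
move=> oU; elim: k f g => [|k IH] f g fg /=.
  by move=> cf x Ux; apply: (continuous_ext_on oU fg Ux); exact: cf.
move=> [cf [df ddf]]; split; last split.
- by move=> x Ux; apply: (continuous_ext_on oU fg Ux); exact: cf.
- move=> x v Ux; apply: near_eq_derivable (df x v Ux).
  exact: (eq_on_near oU fg Ux).
- move=> v; apply: IH (ddf v) => x /[!inE] Ux.
  by apply: near_eq_derive; exact: (eq_on_near oU fg Ux).
Qed.

Lemma Cs_le k f U : Cs k.+1 f U -> Cs k f U.
Proof.
elim: k f => [|k IH] f; first by case.
move=> [cf [df ddf]]; split => //; split => // v; exact/IH/ddf.
Qed.

Lemma Cs_cst k (c : R) U : Cs k (cst c) U.
Proof.
elim: k c => [|k IH] c; first by move=> x _; exact: cst_continuous.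
split; first by move=> x _; exact: cst_continuous.
split; first by move=> x v _; exact: derivable_cst.
move=> v; rewrite (_ : (fun x => _) = cst 0)//.
by apply/funext => x; rewrite derive_cst.
Qed.

Lemma Cs_add k f g U : open U ->
  Cs k f U -> Cs k g U -> Cs k (fun x => f x + g x) U.
Proof.
move=> oU; elim: k f g => [|k IH] f g.
  by move=> cf cg x Ux; apply: continuousD; [exact: cf|exact: cg].
move=> [cf [df ddf]] [cg [dg ddg]]; split.
  by move=> x Ux; apply: continuousD; [exact: cf|exact: cg].
split; first by move=> x v Ux; apply: derivableD; [exact: df|exact: dg].
move=> v; apply: (Cs_ext oU _ (IH _ _ (ddf v) (ddg v))) => x /[!inE] Ux.
by rewrite deriveD//; [exact: df|exact: dg].
Qed.

Lemma Cs_mul k f g U : open U ->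
  Cs k f U -> Cs k g U -> Cs k (fun x => f x * g x) U.
Proof.
move=> oU; elim: k f g => [|k IH] f g.
  by move=> cf cg x Ux; apply: continuousM; [exact: cf|exact: cg].
move=> Cf Cg; have [cf [df ddf]] := Cf; have [cg [dg ddg]] := Cg; split.
  by move=> x Ux; apply: continuousM; [exact: cf|exact: cg].
split; first by move=> x v Ux; apply: derivableM; [exact: df|exact: dg].
move=> v.
apply: (Cs_ext oU _ (Cs_add oU (IH _ _ (Cs_le Cf) (ddg v))
                       (IH _ _ (Cs_le Cg) (ddf v)))) => x /[!inE] Ux.
by rewrite deriveM//; [exact: df|exact: dg].
Qed.

Lemma Cs_opp k f U : open U -> Cs k f U -> Cs k (fun x => - f x) U.
Proof.
move=> oU Cf; apply: (Cs_ext oU _ (Cs_mul oU (Cs_cst k (-1) U) Cf)) => x _.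
by rewrite /= mulN1r.
Qed.

Lemma Cs_sum k (I : Type) (r : seq I) (P : pred I) (F : I -> V -> R) U :
  open U -> (forall i, P i -> Cs k (F i) U) ->
  Cs k (fun x => \sum_(i <- r | P i) F i x) U.
Proof.
move=> oU CF; elim: r => [|i r IH].
  by apply: (Cs_ext oU _ (Cs_cst k 0 U)) => x _; rewrite big_nil.
case Pi: (P i); last first.
  by apply: (Cs_ext oU _ IH) => x _; rewrite big_cons Pi.
by apply: (Cs_ext oU _ (Cs_add oU (CF _ Pi) IH)) => x _; rewrite big_cons Pi.
Qed.

Lemma Cs_prod k (I : Type) (r : seq I) (P : pred I) (F : I -> V -> R) U :
  open U -> (forall i, P i -> Cs k (F i) U) ->
  Cs k (fun x => \prod_(i <- r | P i) F i x) U.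
Proof.
move=> oU CF; elim: r => [|i r IH].
  by apply: (Cs_ext oU _ (Cs_cst k 1 U)) => x _; rewrite big_nil.
case Pi: (P i); last first.
  by apply: (Cs_ext oU _ IH) => x _; rewrite big_cons Pi.
by apply: (Cs_ext oU _ (Cs_mul oU (CF _ Pi) IH)) => x _; rewrite big_cons Pi.
Qed.

Lemma Cs_inv k f U : open U -> (forall x, U x -> f x != 0) ->
  Cs k f U -> Cs k (fun x => (f x)^-1) U.
Proof.
move=> oU f0; elim: k f f0 => [|k IH] f f0.
  by move=> cf x Ux; apply: continuousV; [exact: f0|exact: cf].
move=> Cf; have [cf [df ddf]] := Cf; split.
  by move=> x Ux; apply: continuousV; [exact: f0|exact: cf].
split; first by move=> x v Ux; apply: derivableV; [exact: f0|exact: df].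
move=> v; have Ck := IH _ f0 (Cs_le Cf).
apply: (Cs_ext oU _ (Cs_opp oU (Cs_mul oU (Cs_mul oU Ck Ck) (ddf v)))) => x /[!inE] Ux.
rewrite deriveV//; [|exact: f0|exact: df].
by rewrite -exprVn expr2 scaleNr.
Qed.

Lemma Cs_det k n (M : V -> 'M[R]_n) U : open U ->
  (forall i j, Cs k (fun x => M x i j) U) -> Cs k (fun x => \det (M x)) U.
Proof.
move=> oU CM; apply: Cs_sum => // s _; apply: Cs_mul => //; first exact: Cs_cst.
by apply: Cs_prod => // i _.
Qed.

(** By the cofactor formula each entry of the inverse is a polynomial in the entries of M divided by
    the determinant. *)
Lemma Cs_invmx k n (M : V -> 'M[R]_n) U : open U ->
  (forall x, U x -> M x \in unitmx) ->
  (forall i j, Cs k (fun x => M x i j) U) ->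
  forall i j, Cs k (fun x => invmx (M x) i j) U.
Proof.
move=> oU Mu CM i j.
have Cd : Cs k (fun x => (\det (M x))^-1) U.
  apply: Cs_inv => //; last exact: Cs_det.
  by move=> x /Mu; rewrite unitmxE unitfE.
have Cc : Cs k (fun x => cofactor (M x) j i) U.
  apply: Cs_mul => //; first exact: Cs_cst.
  apply: Cs_det => // a b.
  rewrite (_ : (fun x => _) = fun x => M x (lift j a) (lift i b)).
    exact: CM.
  by apply/funext => x; rewrite !mxE.
apply: (Cs_ext oU _ (Cs_mul oU Cd Cc)) => x /[!inE] /Mu xu.
by rewrite /invmx xu !mxE.
Qed.

Lemma Cs_mulmx k m n p (M : V -> 'M[R]_(m, n)) (N : V -> 'M[R]_(n, p)) U :
  open U ->
  (forall i j, Cs k (fun x => M x i j) U) ->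
  (forall i j, Cs k (fun x => N x i j) U) ->
  forall i j, Cs k (fun x => (M x *m N x) i j) U.
Proof.
move=> oU CM CN i j.
rewrite (_ : (fun x => _) = fun x => \sum_l M x i l * N x l j); last first.
  by apply/funext => x; rewrite mxE.
by apply: Cs_sum => // l _; apply: Cs_mul.
Qed.

End Generic.

Lemma is_derive_coord m (p v : 'rV[R]_m) i j :
  is_derive p v (fun x : 'rV[R]_m => x i j) (v i j).
Proof.
split; first exact: diff_derivable (differentiable_coord _ _ _).
have := @derive_mx R _ _ _ (fun x : 'rV[R]_m => x) p v (@derivable_id R _ p v).
by rewrite derive_id => /matrixP /(_ i j); rewrite mxE => <-.
Qed.

Lemma Cs_coord m k j (U : set 'rV[R]_m) : Cs k (fun x : 'rV[R]_m => x 0 j) U.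
Proof.
case: k => [|k] /=; first by move=> x _; exact: coord_continuous.
split; first by move=> x _; exact: coord_continuous.
split; first by move=> x v _; case: (is_derive_coord x v 0 j).
move=> v; rewrite (_ : (fun x => _) = cst (v 0 j)); first exact: Cs_cst.
by apply/funext => x; rewrite (@derive_val _ _ _ _ _ _ _ (is_derive_coord x v 0 j)).
Qed.

End SmoothCalculus.

(** * Differentiability and the chain rule for C^1 functions *)

Section C1.
Variable R : realType.

Lemma is_derive_line (V W : normedModType R) (F : V -> W) (x w : V) (t : R) :
  derivable F (t *: w + x) w ->
  is_derive t 1 (fun s : R => F (s *: w + x)) ('D_w F (t *: w + x)).
Proof.
move=> dF.
have E : (fun h : R => h^-1 *: (F ((h *: 1 + t) *: w + x) - F (t *: w + x))) =
         (fun h : R => h^-1 *: (F (h *: w + (t *: w + x)) - F (t *: w + x))).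
  by apply/funext => h; rewrite [h *: 1]mulr1 scalerDl addrA.
split; first by rewrite /derivable /= E.
by rewrite /derive /= E.
Qed.

(** The bound |t| <= |h| lets one statement serve both signs of h, as difference quotients require;
    h = 0 is included. *)
Lemma directional_MVT (V : normedModType R) (F : V -> R) (x w : V) (h : R) :
  (forall t : R, `|t| <= `|h| -> derivable F (t *: w + x) w) ->
  exists2 t, `|t| <= `|h| & F (h *: w + x) - F x = h * 'D_w F (t *: w + x).
Proof.
move=> dF.
have dl (t : R) : `|t| <= `|h| -> is_derive t 1 (fun s : R => F (s *: w + x)) ('D_w F (t *: w + x)).
  by move=> th; apply: is_derive_line; exact: dF.
have cl (a b : R) : (forall t, t \in `[a, b] -> `|t| <= `|h|) ->
    {within `[a, b], continuous (fun s : R => F (s *: w + x))}.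
  move=> H; apply: derivable_within_continuous => t /H th.
  by case: (dl _ th).
have [h0|/ltW h0] := leP 0 h.
- have H t : t \in `[0, h] -> `|t| <= `|h|.
    by rewrite in_itv /= => /andP[t0 th]; rewrite !ger0_norm.
  have [t tI E] := MVT_segment h0 (fun t tI => dl t (H _ (subset_itv_oo_cc tI))) (cl _ _ H).
  exists t; first exact: H.
  by move: E; rewrite scale0r add0r subr0 mulrC.
- have H t : t \in `[h, 0] -> `|t| <= `|h|.
    by rewrite in_itv /= => /andP[th t0]; rewrite !ler0_norm// lerN2.
  have [t tI E] := MVT_segment h0 (fun t tI => dl t (H _ (subset_itv_oo_cc tI))) (cl _ _ H).
  exists t; first exact: H.
  move: E; rewrite scale0r add0r sub0r mulrN => /eqP.
  by rewrite eq_sym eqr_oppLR opprB mulrC => /eqP.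
Qed.

Section Linearity.
Variables (V : normedModType R) (F : V -> R) (U : set V).
Hypotheses (oU : open U) (CF : Cs 1 F U).

(* By the mean value theorem along v, evaluated at points tending to x. *)
Lemma derive_dir_is_linear x a v w : U x ->
  'D_(a *: v + w) F x = a * 'D_v F x + 'D_w F x.
Proof.
move=> Ux; apply: cvg_lim => //.
have dw : (fun h : R => h^-1 *: (F (h *: w + x) - F x)) @ 0^' --> 'D_w F x.
  exact: (Cs_derivable CF Ux).
(* The increment along a v + w is split into a step along w from x and then a step along a v from
   the moved point. Only this second step requires continuity of the derivative. *)
have dv : (fun h : R => h^-1 *: (F ((h * a) *: v + (h *: w + x)) - F (h *: w + x)))
    @ 0^' --> a * 'D_v F x.
  apply/cvgrPdist_le => e e0.
  have cD := Cs_continuous (Cs_derive v CF) Ux.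
  have e1 : 0 < e / (`|a| + 1) by rewrite divr_gt0// ltr_wpDl.
  have /nbhs_ballP[r /= r0 Hr] : nbhs x U by exact: open_nbhs_nbhs.
  have /nbhs_ballP[s /= s0 Hs] : \forall z \near x, `|'D_v F x - 'D_v F z| <= e / (`|a| + 1).
    by have /cvgrPdist_le := cD; apply.
  have rs_r : Num.min r s <= r by rewrite ge_min lexx.
  have rs_s : Num.min r s <= s by rewrite ge_min lexx orbT.
  (* K bounds the displacement per unit of h, and the summand 1 keeps it positive; the summand 1 in
     |a| + 1 likewise covers a = 0. *)
  pose K := `|a| * `|v| + `|w| + 1.
  have K0 : 0 < K by rewrite ltr_wpDl// addr_ge0// mulr_ge0.
  near=> h.
  have h0 : h != 0 by near: h; exact: nbhs_dnbhs_neq.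
  have hs : `|h| < Num.min r s / K.
    by near: h; apply: dnbhs0_lt; rewrite divr_gt0// lt_min r0.
  have inb t : `|t| <= `|h * a| -> ball x (Num.min r s) (t *: v + (h *: w + x)).
    move=> th; rewrite -ball_normE /ball_ /=.
    have -> : x - (t *: v + (h *: w + x)) = - (t *: v + h *: w).
      by rewrite addrA opprD addrCA subrr addr0.
    rewrite normrN (le_lt_trans (ler_normD _ _))//.
    rewrite !normrZ; move: hs; rewrite ltr_pdivlMr//; apply: le_lt_trans.
    rewrite /K mulrDr mulr1 mulrDr mulrA -normrM -addrA.
    by rewrite lerD// ?ler_wpM2r// lerDl.
  have [t th ->] := @directional_MVT _ F (h *: w + x) v (h * a) (fun t th => 
     Cs_derivable CF (Hr _ (le_ball rs_r (inb _ th)))).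
  rewrite /GRing.scale /= !mulrA mulVf// mul1r -mulrBr normrM.
  rewrite (le_trans (ler_wpM2l (normr_ge0 _) (Hs _ (le_ball rs_s (inb _ th)))))//.
  by rewrite mulrA ler_pdivrMr ?ltr_wpDl// mulrC ler_wpM2l ?(ltW e0)// lerDl.
rewrite (_ : (fun h => _) = (fun h : R => h^-1 *: (F ((h * a) *: v + (h *: w + x)) - F (h *: w + x))) \+ (fun h : R => h^-1 *: (F (h *: w + x) - F x))).
  exact: cvgD dv dw.
apply/funext => h /=; rewrite -scalerDr; congr (_ *: _).
by rewrite scalerDr scalerA -addrA [RHS]addrA subrK.
Unshelve. all: by end_near. Qed.

End Linearity.

Lemma normr_coord_le n (w : 'rV[R]_n) j : `|w 0 j| <= `|w|.
Proof.
by rewrite [leRHS]/Num.Def.normr/= mx_normrE; exact: (le_bigmax _ _ (0, j)).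
Qed.

Section Frechet.
Variables (n : nat) (F : 'rV[R]_n -> R) (U : set 'rV[R]_n).
Hypotheses (oU : open U) (CF : Cs 1 F U).

Lemma derive_dir_sum x w : U x ->
  'D_w F x = \sum_(j < n) w 0 j * 'D_(delta_mx 0 j) F x.
Proof.
move=> Ux.
have H (s : seq 'I_n) : 'D_(\sum_(j <- s) w 0 j *: delta_mx 0 j) F x =
    \sum_(j <- s) w 0 j * 'D_(delta_mx 0 j) F x.
  elim: s => [|j s IH]; first by rewrite !big_nil derive0.
  by rewrite !big_cons (derive_dir_is_linear oU CF)// IH.
by rewrite {1}[w]row_sum_delta H.
Qed.

(** The mean value theorem along w leaves the difference of two derivatives in direction w, a sum of
    n differences of partial derivatives weighted by coordinates of w. Each is made at most e / (n +
    1), the denominator being nonzero even for n = 0. *)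
Lemma C1_littleo x e : U x -> 0 < e -> \forall w \near (0 : 'rV[R]_n),
    `|F (w + x) - (F x + 'D_w F x)| <= e * `|w|.
Proof.
move=> Ux e0; pose e1 := e / n.+1%:R.
have e10 : 0 < e1 by rewrite divr_gt0.
have : \forall y \near x, U y /\
    forall j, `|'D_(delta_mx 0 j) F x - 'D_(delta_mx 0 j) F y| <= e1.
  near=> y; split; first by near: y; exact: open_nbhs_nbhs.
  near: y; apply: filter_forall => j.
  by have /cvgrPdist_le := Cs_continuous (Cs_derive (delta_mx 0 j) CF) Ux; apply.
move=> /nbhs_ballP[r /= r0 Hr].
near=> w.
have wr : `|w| < r.
  near: w; apply/nbhs_ballP; exists r => // y.
  by rewrite -ball_normE /ball_ /= sub0r normrN.
have inb (t : R) : `|t| <= `|1 : R| -> ball x r (t *: w + x).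
  rewrite normr1 => t1; rewrite -ball_normE /ball_ /= opprD addrCA subrr addr0.
  by rewrite normrN normrZ (le_lt_trans _ wr)// ler_piMl.
have [t t1] := @directional_MVT _ F x w 1 (fun t t1 => Cs_derivable CF (Hr _ (inb _ t1)).1).
rewrite scale1r mul1r => E.
rewrite [X in `|X|](_ : _ = F (w + x) - F x - 'D_w F x); last first.
  by rewrite opprD addrA.
have [Uy Hy] := Hr _ (inb _ t1).
rewrite E (derive_dir_sum _ Uy) (derive_dir_sum _ Ux) -sumrB.
rewrite (le_trans (ler_norm_sum _ _ _))//.
apply: (@le_trans _ _ (\sum_(j < n) `|w| * e1)).
  apply: ler_sum => j _; rewrite -mulrBr normrM ler_pM//; last by rewrite distrC.
  exact: normr_coord_le.
rewrite sumr_const card_ord -mulr_natl mulrCA mulrC ler_wpM2r//.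
by rewrite /e1 mulrCA ler_piMr ?(ltW e0)// ler_pdivrMr// mul1r ler_nat.
Unshelve. all: by end_near. Qed.

Lemma C1_is_diff x : U x -> is_diff x F (fun w => 'D_w F x).
Proof.
move=> Ux.
have lin : linear (fun w => 'D_w F x) by move=> a v w; exact: (derive_dir_is_linear oU CF).
pose dM := GRing.isLinear.Build _ _ _ _ _ lin.
pose d : {linear 'rV[R]_n -> R} := HB.pack (fun w => 'D_w F x) dM.
have dc : continuous d.
  move=> w; rewrite (_ : d = (fun w => \sum_(j < n) w 0 j * 'D_(delta_mx 0 j) F x) :> (_ -> _)).
    apply: (@Cs_continuous _ _ 0 _ setT) => //.
    apply: Cs_sum; first exact: openT.
    move=> i _; apply: Cs_mul; [exact: openT|exact: Cs_coord|exact: Cs_cst].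
  by apply/funext => v; exact: derive_dir_sum.
have E : 'd F x = d :> (_ -> _) by apply: diff_unique => //; apply/eqaddoP => e e0; exact: C1_littleo.
split; last by rewrite E.
by apply/diff_locallyP; rewrite E; split => //; apply/eqaddoP => e e0; exact: C1_littleo.
Qed.

End Frechet.

Section Chain.
Variables (V : normedModType R) (n : nat) (phi : V -> 'rV[R]_n) (F : 'rV[R]_n -> R).
Variables (U : set 'rV[R]_n).
Hypotheses (oU : open U) (CF : Cs 1 F U).

(** The inner map has a derivative in the single direction v and may fail to be differentiable.
    Restricted to the line s |-> s v + p it is a differentiable curve, and the usual chain rule
    applies at s = 0. *)
Lemma is_derive_comp_C1 p v : U (phi p) -> derivable phi p v ->
  is_derive p v (F \o phi) ('D_('D_v phi p) F (phi p)).
Proof.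
move=> Up dphi.
have dF := C1_is_diff oU CF Up.
have p0 : (0 : R) *: v + p = p by rewrite scale0r add0r.
have dphi0 : derivable phi ((0 : R) *: v + p) v by rewrite p0.
have := is_derive_line dphi0; rewrite p0; set g := (fun s : R => _) => -[dg Dg].
have g0 : g 0 = phi p by rewrite /g p0.
have dfg : differentiable g 0 by apply/derivable1_diffP.
have dFg : is_diff (g 0) F (fun w => 'D_w F (phi p)) by rewrite g0.
have dFog : derivable (F \o phi) p v.
  apply/derivable1P; apply/derivable1_diffP.
  by apply: (differentiable_comp dfg).
split => //.
have dFog0 : derivable (F \o phi) ((0 : R) *: v + p) v by rewrite p0.
have [_] := is_derive_line dFog0; rewrite p0 => <-.
have -> : (fun s : R => (F \o phi) (s *: v + p)) = F \o g by [].
rewrite deriveE; last exact: (differentiable_comp dfg).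
have [dF' EF] := dFg.
have /(congr1 (fun f => f (1 : R))) /= -> := diff_comp dfg dF'.
have := congr1 (fun f => f ('d g 0 (1 : R))) EF => /= ->.
by rewrite -(deriveE (1 : R) dfg) Dg.
Qed.

End Chain.

Lemma continuous_rV (T : topologicalType) n (f : T -> 'rV[R]_n) x :
  (forall j, {for x, continuous (fun p => f p 0 j)}) -> {for x, continuous f}.
Proof.
move=> cf; apply/cvgrPdist_le => e e0; near=> y.
rewrite [leLHS]/Num.Def.normr/= mx_normrE (bigmax_le _ (ltW e0))//= => -[i j] _.
rewrite !mxE /= (ord1 i); move: j; near: y; apply: filter_forall => j.
by move/cvgrPdist_le : (cf j); apply.
Unshelve. all: by end_near. Qed.

Lemma derivable_rV (V : normedModType R) n (f : V -> 'rV[R]_n) x v :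
  (forall j, derivable (fun p => f p 0 j) x v) -> derivable f x v.
Proof. by move=> df; apply/derivable_mxP => i j; rewrite ord1. Qed.

Lemma derive_rV (V : normedModType R) n (f : V -> 'rV[R]_n) x v j :
  derivable f x v -> 'D_v (fun p => f p 0 j) x = ('D_v f x) 0 j.
Proof. by move=> df; rewrite (derive_mx df) mxE. Qed.

(** Induction on k with F general: the derivative of the composite is a sum of derivatives of
    coordinates of phi times partial derivatives of F composed with phi, to which the induction
    hypothesis applies. *)
Lemma Cs_comp (V : normedModType R) n k (phi : V -> 'rV[R]_n)
    (F : 'rV[R]_n -> R) (U : set V) (W : set 'rV[R]_n) :
  open U -> open W -> (forall p, U p -> W (phi p)) ->
  (forall j, Cs k (fun p => phi p 0 j) U) -> Cs k F W -> Cs k (F \o phi) U.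
Proof.
move=> oU oW UW; elim: k F => [|k IH] F.
  move=> Cphi CF p Up; apply: continuous_comp; last by apply: CF; exact: UW.
  by apply: continuous_rV => j; exact: Cphi.
move=> Cphi CF.
have dphi p v : U p -> derivable phi p v.
  by move=> Up; apply: derivable_rV => j; exact: Cs_derivable (Cphi j) Up.
have CF1 : Cs 1 F W by elim: k CF {IH Cphi} => // k IH /Cs_le.
split.
  move=> p Up; apply: continuous_comp; last exact: Cs_continuous CF (UW _ Up).
  by apply: continuous_rV => j; exact: Cs_continuous (Cphi j) Up.
split.
  by move=> p v Up; case: (is_derive_comp_C1 oW CF1 (UW _ Up) (dphi p v Up)).
move=> v.
have C1 : Cs k (fun p => \sum_(j < n) 'D_v (fun p => phi p 0 j) p *
                  ('D_(delta_mx 0 j) F \o phi) p) U.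
  apply: Cs_sum => // j _; apply: Cs_mul => //; first exact: Cs_derive (Cphi j).
  by apply: IH; [move=> i; exact/Cs_le/Cphi|exact: Cs_derive].
apply: (Cs_ext oU _ C1) => p /[!inE] Up.
have [_ ->] := is_derive_comp_C1 oW CF1 (UW _ Up) (dphi p v Up).
rewrite (derive_dir_sum oW CF1 _ (UW _ Up)); apply: eq_bigr => j _.
by rewrite (derive_rV _ (dphi p v Up)).
Qed.

Lemma Ck_Cs m n k (f : 'rV[R]_m.+1 -> 'rV[R]_n.+1) (U : set 'rV[R]_m.+1) :
  open U -> (Ck k f U <-> forall j, Cs k (fun p => f p 0 j) U).
Proof.
move=> oU; elim: k f => [|k IH] f /=.
  split=> [cf j x Ux|cf x Ux]; last by apply: continuous_rV => j; exact: cf.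
  by apply: (@continuous_comp _ _ _ f (fun y : 'rV[R]_n.+1 => y 0 j)); [exact: cf|exact: coord_continuous].
split=> [[cf [df ddf]] j|Cf].
  split.
    by move=> x Ux; apply: (@continuous_comp _ _ _ f (fun y : 'rV[R]_n.+1 => y 0 j)); [exact: cf|exact: coord_continuous].
  split; first by move=> x v Ux; exact: (derivable_mxP _ _ _).1 (df x v Ux) 0 j.
  move=> v; apply: (Cs_ext oU _ ((IH _).1 (ddf v) j)) => x /[!inE] Ux.
  by rewrite derive_rV//; exact: df.
have df x v : U x -> derivable f x v.
  by move=> Ux; apply: derivable_rV => j; exact: Cs_derivable (Cf j) Ux.
split; first by move=> x Ux; apply: continuous_rV => j; exact: (Cf j).1.
split=> // v; apply/IH => j.
apply: (Cs_ext oU _ (Cs_derive v (Cf j))) => x /[!inE] Ux.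
by rewrite derive_rV//; exact: df.
Qed.

End C1.

(** * Contraction of the unit sphere *)

Section Trig.
Variable R : realType.

(* The arc length estimate |(asin A)'| <= l breaks down where A = 1 or -1; asin (k A) is
   smooth everywhere for k < 1, and k = sin (l s) / sg makes the estimate sharp enough. *)
Lemma asin_calibration (A dA : R -> R) (s l sg : R) :
  0 < s -> s <= pi / 2 -> 0 < l -> l < 1 ->
  (forall t : R, is_derive t 1 A (dA t)) ->
  (forall t, dA t ^+ 2 <= l ^+ 2 * (1 - A t ^+ 2)) ->
  A s = sg -> A (- s) = - sg -> sg <= sin (l * s).
Proof.
move=> s0 spi l0 l1 dA_ bA As ANs; rewrite leNgt; apply/negP => sgl.
have ls0 : 0 < l * s by rewrite mulr_gt0.
have lspi : l * s < pi / 2 by rewrite (lt_le_trans _ spi)// gtr_pMl.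
have sin0 : 0 < sin (l * s).
  by apply: sin_gt0_pihalf; rewrite ls0.
have sg0 : 0 < sg by exact: lt_trans sgl.
pose k := sin (l * s) / sg.
have k0 : 0 < k by rewrite divr_gt0.
have k1 : k < 1 by rewrite ltr_pdivrMr// mul1r.
have A1 (t : R) : A t ^+ 2 <= 1.
  have := bA t; have := sqr_ge0 (dA t); have : 0 < l ^+ 2 by rewrite exprn_gt0.
  by move=> l2 d0 dl; rewrite -subr_ge0 -(pmulr_rge0 _ l2) (le_trans d0).
have k2 : k ^+ 2 < 1 by rewrite expr_lt1// ltW.
have kA1 (t : R) : (k * A t) ^+ 2 < 1.
  rewrite exprMn (le_lt_trans _ k2)// ler_piMr// exprn_ge0// ltW//.
have kA (t : R) : -1 < k * A t < 1.
  by rewrite -ltr_norml -(@ltr_pXn2r _ 2) ?nnegrE// expr1n real_normK ?num_real.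
pose W := asin \o (fun t => k * A t).
have dW (t : R) : is_derive t 1 W ((Num.sqrt (1 - (k * A t) ^+ 2))^-1 * (k * dA t)).
  have d1 : is_derive t 1 (fun t => k * A t) (k * dA t).
    by apply: is_derive_eq; rewrite /GRing.scale.
  have d2 := is_derive1_asin (kA t).
  exact: is_derive1_comp.
have sN : - s < s by lra.
have cW : {within `[- s, s], continuous W}.
  by apply: derivable_within_continuous => t _; case: (dW t).
(* By the choice of k, W rises by 2 l s over an interval of length 2 s, so W' = l at some t.
   Squared, k^2 A'^2 = l^2 (1 - k^2 A^2), which exceeds k^2 l^2 (1 - A^2) because k < 1; this
   contradicts [bA]. *)
have [t _] := MVT sN (fun t _ => dW t) cW.
have Ws : W s = l * s.
  rewrite /W /= As /k divfK ?gt_eqF// sinK// in_itv /= ltW// ?(ltW lspi)//.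
  by rewrite (lt_trans _ ls0)// oppr_lt0 divr_gt0// pi_gt0.
have WNs : W (- s) = - (l * s).
  rewrite /W /= ANs mulrN /k divfK ?gt_eqF// -sinN sinK// in_itv /= lerN2 (ltW lspi) /=.
  by rewrite (le_trans (ltW (_ : - (l * s) < 0)))// ?oppr_lt0// divr_ge0// pi_ge0.
rewrite Ws WNs; set q := Num.sqrt _ => E.
have q2 : q ^+ 2 = 1 - (k * A t) ^+ 2.
  by rewrite sqr_sqrtr// subr_ge0 ltW.
have q0 : 0 < q by rewrite sqrtr_gt0 subr_gt0.
have E2 : k * dA t = l * q.
  have : q^-1 * (k * dA t) * (s + s) = l * (s + s) by move: E; lra.
  have ss0 : s + s != 0 by rewrite gt_eqF// addr_gt0.
  move=> /(mulIf ss0) E1.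
  by rewrite -E1 [RHS]mulrAC mulVf ?mul1r// gt_eqF.
have := bA t.
have : (k * dA t) ^+ 2 = l ^+ 2 * (1 - (k * A t) ^+ 2) by rewrite E2 exprMn q2.
rewrite (exprMn 2 k (dA t)) (exprMn 2 k (A t)) => E3.
rewrite -(ler_pM2l (_ : 0 < k ^+ 2)) ?exprn_gt0// E3.
have l2 : 0 < l ^+ 2 by rewrite exprn_gt0.
have := mulr_gt0 l2 (_ : 0 < 1 - k ^+ 2); rewrite subr_gt0 => /(_ k2).
lra.
Qed.

(** Concavity of sin on [0, pi], in the form that sin (th t) - th sin t has derivative th (cos (th
    t) - cos t) >= 0. *)
Lemma sin_scale_ge (th s : R) : 0 <= th <= 1 -> 0 <= s <= pi ->
  th * sin s <= sin (th * s).
Proof.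
move=> /andP[th0 th1] /andP[s0 spi].
pose f := fun t : R => sin (th * t) - th * sin t.
have df (t : R) : is_derive t 1 f (th * cos (th * t) - th * cos t).
  have d1 : is_derive t 1 (fun t => sin (th * t)) (th * cos (th * t)).
    have d0 : is_derive t 1 (fun t : R => th * t) th.
      by apply: is_derive_eq; rewrite /GRing.scale /= mulr1.
    by rewrite [th * _]mulrC; apply: is_derive1_comp.
  by apply: is_derive_eq.
have [|t] := MVT_segment s0 (fun t _ => df t).
  by apply: derivable_within_continuous => t _; case: (df t).
rewrite in_itv /= => /andP[t0 ts].
rewrite /f mulr0 sin0 mulr0 !subr0 => E.
rewrite -subr_ge0 E; apply: mulr_ge0 => //; rewrite -mulrBr.
apply: mulr_ge0 => //; rewrite subr_ge0.
rewrite leNgt; apply/negP => H.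
have tpi : t <= pi by exact: le_trans spi.
have tht : th * t <= t by rewrite ler_piMl.
have I1 : th * t \in `[0, pi] by rewrite in_itv /= mulr_ge0// (le_trans tht).
have I2 : t \in `[0, pi] by rewrite in_itv /= t0.
by move: H; rewrite ltr_cos// ltNge tht.
Qed.

(** From sin s - sin (l s) = 2 cos ((1 + l) s / 2) sin ((1 - l) s / 2): the cosine is at least its
    value C at s = pi / 2, positive since l < 1, and the sine is at least (1 - l) / 2 times sin s.
    Hence mu = 1 - C (1 - l). *)
Lemma sin_contraction (l : R) : 0 < l -> l < 1 ->
  exists2 mu, 0 < mu < 1 & forall s, 0 <= s <= pi / 2 -> sin (l * s) <= mu * sin s.
Proof.
move=> l0 l1; have pi0 := pi_gt0 R.
pose C := cos ((1 + l) * (pi / 4)).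
have a0 : 0 <= (1 + l) * (pi / 4) by rewrite mulr_ge0 ?addr_ge0// ?ltW// divr_gt0.
have api : (1 + l) * (pi / 4) < pi / 2.
  have -> : pi / 2 = 2 * (pi / 4) :> R by lra.
  by rewrite ltr_pM2r; [lra|rewrite divr_gt0].
have C0 : 0 < C by apply: cos_gt0_pihalf; rewrite api andbT (lt_le_trans _ a0)// oppr_lt0 divr_gt0.
have C1 : C <= 1 by exact: cos_le1.
exists (1 - C * (1 - l)); first by apply/andP; split; nra.
move=> s /andP[s0 spi].
have E1 : s = (1 + l) / 2 * s + (1 - l) / 2 * s by lra.
have E2 : l * s = (1 + l) / 2 * s - (1 - l) / 2 * s by lra.
have E : sin s - sin (l * s) = 2 * (cos ((1 + l) / 2 * s) * sin ((1 - l) / 2 * s)).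
  by rewrite {1}E1 E2 sinD sinB; ring.
have H1 : (1 - l) / 2 * sin s <= sin ((1 - l) / 2 * s).
  by apply: sin_scale_ge; apply/andP; split; lra.
have H2 : C <= cos ((1 + l) / 2 * s).
  rewrite leNgt; apply/negP => H.
  have as' : (1 + l) / 2 * s <= (1 + l) * (pi / 4) by nra.
  have as0 : 0 <= (1 + l) / 2 * s by rewrite mulr_ge0// divr_ge0// addr_ge0// ltW.
  have I1 : (1 + l) / 2 * s \in `[0, pi] by rewrite in_itv /= as0 /= (le_trans as')//; lra.
  have I2 : (1 + l) * (pi / 4) \in `[0, pi] by rewrite in_itv /= a0 /=; lra.
  by move: H; rewrite ltr_cos// ltNge as'.
have ss0 : 0 <= sin s by apply: sin_ge0_pi; rewrite s0 /=; lra.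
have := ler_pM (ltW C0) (mulr_ge0 (_ : 0 <= (1 - l) / 2) ss0) H2 H1.
have -> : 0 <= (1 - l) / 2 by lra.
move=> /(_ isT); lra.
Qed.
End Trig.

(** * Inner product, great circles and chordal contraction *)

Section Dot.
Variables (R : realType) (n : nat).
Implicit Types u v w x y : 'rV[R]_n.

Lemma dotvC u v : dotv u v = dotv v u.
Proof. by apply: eq_bigr => i _; rewrite mulrC. Qed.

Lemma dotvDl u v w : dotv (u + v) w = dotv u w + dotv v w.
Proof. by rewrite -big_split; apply: eq_bigr => i _; rewrite mxE mulrDl. Qed.

Lemma dotvZl a u w : dotv (a *: u) w = a * dotv u w.
Proof. by rewrite /dotv big_distrr /=; apply: eq_bigr => i _; rewrite mxE mulrA. Qed.

Lemma dotvNl u w : dotv (- u) w = - dotv u w.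
Proof. by rewrite -scaleN1r dotvZl mulN1r. Qed.

Lemma dotvDr u v w : dotv w (u + v) = dotv w u + dotv w v.
Proof. by rewrite dotvC dotvDl !(dotvC w). Qed.

Lemma dotvZr a u w : dotv w (a *: u) = a * dotv w u.
Proof. by rewrite dotvC dotvZl (dotvC w). Qed.

Lemma dotvNr u w : dotv w (- u) = - dotv w u.
Proof. by rewrite dotvC dotvNl (dotvC w). Qed.

Definition dotvE := (dotvDl, dotvDr, dotvNl, dotvNr, dotvZl, dotvZr).

Lemma dot0v u : dotv 0 u = 0.
Proof. by rewrite -(scale0r u) dotvZl mul0r. Qed.

Lemma dotv_ge0 u : 0 <= dotv u u.
Proof. by apply: sumr_ge0 => i _; rewrite -expr2 sqr_ge0. Qed.

Lemma sqr_coord_le_dotv u i : u 0 i ^+ 2 <= dotv u u.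
Proof.
rewrite /dotv (bigD1 i)//= -expr2 lerDl.
by apply: sumr_ge0 => j _; rewrite -expr2 sqr_ge0.
Qed.

Lemma dotv_eq0 u : dotv u u = 0 -> u = 0.
Proof.
move=> u0; apply/rowP => i; rewrite mxE; apply/eqP; rewrite -sqrf_eq0 eq_le sqr_ge0.
by rewrite andbT -u0 sqr_coord_le_dotv.
Qed.

Lemma dotv_gt0 u : u != 0 -> 0 < dotv u u.
Proof.
move=> u0; rewrite lt_neqAle dotv_ge0 andbT eq_sym.
by apply: contra_neq u0 => /dotv_eq0.
Qed.

Lemma unit_neq0 u : dotv u u = 1 -> u != 0.
Proof. by move=> u1; apply: contra_eq_neq u1 => ->; rewrite dot0v eq_sym oner_neq0. Qed.

Lemma dotv_CS u v : dotv u v ^+ 2 <= dotv u u * dotv v v.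
Proof.
have [->|v0] := eqVneq v 0.
  by rewrite dotvC !dot0v mulr0 expr0n.
have v0' := dotv_gt0 v0.
have := dotv_ge0 (dotv v v *: u - dotv u v *: v).
rewrite !dotvE (dotvC v u).
move: (dotv v v) v0' (dotv u v) (dotv u u) => a a0 b c.
rewrite [X in 0 <= X](_ : _ = a * (c * a - b ^+ 2)); last by ring.
by rewrite pmulr_rge0// subr_ge0.
Qed.

End Dot.

Section Ortho.
Variable R : realType.

Lemma unit_normalize n (v : 'rV[R]_n) : v != 0 ->
  dotv ((Num.sqrt (dotv v v))^-1 *: v) ((Num.sqrt (dotv v v))^-1 *: v) = 1.
Proof.
move=> v0; have := dotv_gt0 v0; rewrite !dotvE => d0.
rewrite mulrA -expr2 exprVn sqr_sqrtr ?dotv_ge0// mulVf// gt_eqF//.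
Qed.

(** The column u^T has rank at most 1 in dimension at least 2, so its left kernel contains a nonzero
    row. *)
Lemma exists_unit_orthogonal n (u : 'rV[R]_n.+2) :
  exists v, dotv v v = 1 /\ dotv v u = 0.
Proof.
have kn0 : kermx (u^T) != 0.
  rewrite -mxrank_eq0 -lt0n mxrank_ker subn_gt0.
  by rewrite (leq_ltn_trans (rank_leq_col _)).
pose w := nz_row (kermx u^T).
have w0 : w != 0 by rewrite nz_row_eq0.
have wu : dotv w u = 0.
  have /sub_kermxP/matrixP/(_ 0 0) := nz_row_sub (kermx u^T).
  by rewrite !mxE => <-; apply: eq_bigr => i _; rewrite !mxE.
exists ((Num.sqrt (dotv w w))^-1 *: w); split; first exact: unit_normalize.
by rewrite dotvZl wu mulr0.
Qed.

Definition sphere n : set 'rV[R]_n := [set x | dotv x x = 1].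

(** Puts x and y at the parameters -s and s of a great circle through their midpoint m, with u the
    direction of the chord: the symmetric position required by [asin_calibration]. *)
Lemma sphere_bisector n (x y : 'rV[R]_n.+2) : sphere x -> sphere y -> x != y ->
  exists (m u : 'rV[R]_n.+2) (s : R),
   [/\ dotv m m = 1, dotv u u = 1, dotv m u = 0, 0 < s <= pi / 2 &
     [/\ y = cos s *: m + sin s *: u, x = cos s *: m - sin s *: u &
     dotv (y - x) (y - x) = 4 * sin s ^+ 2]].
Proof.
rewrite /sphere /= => x1 y1 xy.
pose d := dotv (y - x) (y - x).
have d0 : 0 < d by rewrite dotv_gt0// subr_eq0 eq_sym.
have ed : d = 2 - 2 * dotv x y by rewrite /d !dotvE x1 y1 (dotvC y x); ring.
have es : dotv (x + y) (x + y) = 4 - d by rewrite ed !dotvE x1 y1 (dotvC y x); ring.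
have d4 : d <= 4 by rewrite -subr_ge0 -es dotv_ge0.
pose sg := Num.sqrt d / 2.
have sg0 : 0 < sg by rewrite divr_gt0// sqrtr_gt0.
have sg2 : sg ^+ 2 = d / 4 by rewrite exprMn sqr_sqrtr ?ltW// exprVn; lra.
have sg1 : sg <= 1 by rewrite -(@ler_pXn2r _ 2) ?nnegrE ?(ltW sg0)// sg2; lra.
have sgI : -1 <= sg <= 1 by rewrite sg1 andbT (le_trans _ (ltW sg0)).
pose s := asin sg.
have sins : sin s = sg by rewrite asinK// in_itv.
have coss2 : cos s ^+ 2 = (4 - d) / 4 by rewrite cos2sin2 sins sg2; lra.
have s0 : 0 < s.
  rewrite ltNge; apply/negP => s0.
  have : 0 <= sin (- s).
    by apply: sin_ge0_pi; have := asin_geNpi2 sgI; have := pi_gt0 R; rewrite -/s; lra.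
  by rewrite sinN sins oppr_ge0 leNgt sg0.
pose u := (2 * sg)^-1 *: (y - x).
have u1 : dotv u u = 1.
  rewrite /u dotvZl dotvZr -/d mulrA -expr2 exprVn exprMn sg2.
  by move: d d0 {ed es d4 sg sg0 sg2 sg1 sgI s sins coss2 s0 u} => d d0; field; rewrite gt_eqF.
have sp : dotv (x + y) (y - x) = 0 by rewrite !dotvE x1 y1 (dotvC y x); ring.
have yx : y - x = (2 * sg) *: u by rewrite scalerA divff ?scale1r// mulf_neq0// gt_eqF.
have [m [m1 mu xym]] : exists m, [/\ dotv m m = 1, dotv m u = 0 & x + y = (2 * cos s) *: m].
  (* For antipodal points x + y = 0 determines no midpoint, and any unit vector orthogonal to the
     chord serves as m. *)
  have [c0|c0] := eqVneq (cos s) 0.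
    have [m [m1 mu]] := exists_unit_orthogonal u; exists m; split => //.
    rewrite c0 mulr0 scale0r; apply: dotv_eq0; rewrite es.
    by move: coss2; rewrite c0 expr0n /=; lra.
  exists ((2 * cos s)^-1 *: (x + y)); split.
  - rewrite dotvZl dotvZr es mulrA -expr2 exprVn exprMn coss2.
    have d40 : 4 - d != 0.
      by apply: contra_neq c0 => d40; apply/eqP; rewrite -sqrf_eq0 coss2 d40 mul0r.
    by move: d40; move: (4 - d) => e e0; field.
  - by rewrite /u dotvZl dotvZr sp !mulr0.
  - by rewrite scalerA divff ?scale1r// mulf_neq0.
exists m, u, s; split => //; first by rewrite s0 asin_lepi2.
rewrite sins; split.
- by apply/rowP => i; move/rowP: yx => /(_ i); move/rowP: xym => /(_ i); rewrite !mxE; lra.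
- by apply/rowP => i; move/rowP: yx => /(_ i); move/rowP: xym => /(_ i); rewrite !mxE; lra.
- by rewrite -/d sg2; lra.
Qed.

Section Contraction.
Variables (n : nat) (h : 'rV[R]_n.+2 -> 'rV[R]_n.+2) (W : set 'rV[R]_n.+2) (l : R).
Hypotheses (oW : open W) (SW : @sphere _ `<=` W) (Ch : forall j, Cs 1 (fun x => h x 0 j) W)
  (hS : forall x, sphere x -> sphere (h x)).

Lemma derivable_on x v : W x -> derivable h x v.
Proof. by move=> Wx; apply: derivable_rV => j; exact: Cs_derivable (Ch j) Wx. Qed.

(** The orthogonality comes from differentiating the constant |h (c t)|^2 = 1: the image curve has
    velocity tangent to the sphere. *)
Lemma great_circle_derive (m u : 'rV[R]_n.+2) (t : R) :
  dotv m m = 1 -> dotv u u = 1 -> dotv m u = 0 ->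
  let c := fun t : R => cos t *: m + sin t *: u in
  let c' := fun t : R => - sin t *: m + cos t *: u in
  [/\ sphere (c t), dotv (c' t) (c' t) = 1,
    forall j, is_derive t 1 (fun t => h (c t) 0 j) ('D_(c' t) h (c t) 0 j) &
    dotv (h (c t)) ('D_(c' t) h (c t)) = 0].
Proof.
move=> m1 u1 mu c c'.
have Sc s : sphere (c s).
  rewrite /sphere /= /c !dotvE m1 u1 (dotvC u m) mu !mulr0 !mulr1 addr0 add0r -!expr2.
  exact: cos2Dsin2.
have c'1 s : dotv (c' s) (c' s) = 1.
  rewrite /c' !dotvE m1 u1 (dotvC u m) mu !mulr0 !mulr1 addr0 add0r mulrNN -!expr2.
  by rewrite addrC cos2Dsin2.
have dcj (s : R) j : is_derive s 1 (fun t => c t 0 j) (c' s 0 j).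
  rewrite (_ : (fun t => c t 0 j) = (fun t => cos t * m 0 j + sin t * u 0 j)); last first.
    by apply/funext => r; rewrite !mxE.
  by apply: is_derive_eq; rewrite !mxE /GRing.scale /=; ring.
have dc (s : R) : derivable c s 1 by apply: derivable_rV => j; case: (dcj s j).
have Dc (s : R) : 'D_1 c s = c' s.
  by apply/rowP => j; rewrite -(derive_rV _ (dc s)); case: (dcj s j).
have dh (s : R) j : is_derive s 1 (fun t => h (c t) 0 j) ('D_(c' s) h (c s) 0 j).
  have := is_derive_comp_C1 oW (Ch j) (SW (Sc s)) (dc s).
  by rewrite Dc (derive_rV _ (derivable_on (SW (Sc s)))).
split => //.
have : is_derive t 1 (fun s => \sum_j h (c s) 0 j * h (c s) 0 j)
   (\sum_j (h (c t) 0 j * 'D_(c' t) h (c t) 0 j + h (c t) 0 j * 'D_(c' t) h (c t) 0 j)).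
  rewrite (_ : (fun s => _) = \sum_j (fun s => h (c s) 0 j * h (c s) 0 j)); last first.
    by apply/funext => s; rewrite fct_sumE.
  apply: is_derive_sum => j; have H := dh t j.
  exact: is_deriveM.
rewrite (_ : (fun s => _) = cst 1); last first.
  by apply/funext => s; exact: (hS (Sc s)).
move=> [_]; rewrite derive_cst big_split /= -/(dotv _ _) => /esym.
by rewrite -mulr2n => /eqP; rewrite mulrn_eq0 /= => /eqP.
Qed.

Hypotheses (l0 : 0 < l) (l1 : l < 1)
  (hl : forall x w, sphere x -> dotv ('D_w h x) ('D_w h x) <= l ^+ 2 * dotv w w).

Lemma sphere_contraction : exists2 mu, 0 < mu < 1 &
  forall x y, sphere x -> sphere y ->
    dotv (h x - h y) (h x - h y) <= mu ^+ 2 * dotv (x - y) (x - y).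
Proof.
have [mu mu01 Hmu] := sin_contraction l0 l1; exists mu => // y x Sy Sx.
have [->|xy] := eqVneq x y; first by rewrite !subrr !dot0v mulr0.
have [->|hxy] := eqVneq (h x) (h y).
  by rewrite subrr dot0v; apply: mulr_ge0; rewrite ?sqr_ge0 ?dotv_ge0.
have [m [u [s [m1 u1 mu0 /andP[s0 spi] [ey ex ed]]]]] := sphere_bisector Sx Sy xy.
have [m' [u' [s' [m'1 u'1 mu'0 s'I [ey' ex' ed']]]]] :=
  sphere_bisector (hS Sx) (hS Sy) hxy.
have GC t := great_circle_derive t m1 u1 mu0.
pose c := fun t : R => cos t *: m + sin t *: u.
pose c' := fun t : R => - sin t *: m + cos t *: u.
(* A measures the image of the great circle along the direction u' of the image chord, so that A =
   sin s' and - sin s' at its ends. The calibration gives sin s' <= sin (l s), and chords have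
   length 2 sin. *)
pose A := fun t => dotv (h (c t)) u'.
have dA (t : R) : is_derive t 1 A (dotv ('D_(c' t) h (c t)) u').
  rewrite (_ : A = \sum_j (fun s => h (c s) 0 j * u' 0 j)); last first.
    by apply/funext => r; rewrite fct_sumE.
  apply: is_derive_sum => j; have [_ _ /(_ j) H _] := GC t.
  by apply: is_derive_eq; rewrite /GRing.scale /= mulr0 add0r mulrC.
have bA t : (dotv ('D_(c' t) h (c t)) u') ^+ 2 <= l ^+ 2 * (1 - A t ^+ 2).
  have [Sc c'1 _ ort] := GC t.
  (* The velocity is orthogonal to h (c t), so it sees only the tangential part z of u', of squared
     length 1 - A^2. *)
  pose z := u' - A t *: h (c t).
  have -> : dotv ('D_(c' t) h (c t)) u' = dotv ('D_(c' t) h (c t)) z.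
    by rewrite /z !dotvE (dotvC _ (h _)) ort mulr0 subr0.
  have zz : dotv z z = 1 - A t ^+ 2.
    have hh : dotv (h (c t)) (h (c t)) = 1 by exact: hS.
    rewrite /z !dotvE u'1 hh (dotvC u') -/(A t); ring.
  rewrite (le_trans (dotv_CS _ _))// zz ler_wpM2r//; first by rewrite -zz dotv_ge0.
  by rewrite (le_trans (hl _ Sc))// c'1 mulr1.
have As : A s = sin s'.
  by rewrite /A /c -ey ey' !dotvE mu'0 u'1 mulr0 mulr1 add0r.
have ANs : A (- s) = - sin s'.
  by rewrite /A /c cosN sinN scaleNr -ex ex' !dotvE mu'0 u'1 mulr0 mulr1 add0r.
have H := asin_calibration s0 spi l0 l1 dA bA As ANs.
rewrite ed ed' [leRHS]mulrCA ler_pM2l// -exprMn.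
have sin0 : 0 <= sin s'.
  by apply: sin_ge0_pi; case/andP: s'I; have := pi_gt0 R; lra.
have H2 : sin (l * s) <= mu * sin s by apply: Hmu; rewrite ltW.
have H3 := le_trans H H2.
by rewrite ler_pXn2r// nnegrE// (le_trans sin0).
Qed.
End Contraction.
End Ortho.

(** * Fixed points depending smoothly on a rotation *)

Section FixedPoint.
Variable R : realType.

Lemma dotv_mulmx_orthogonal n (Q : 'M[R]_n) x y : Q *m Q^T = 1%:M ->
  dotv (x *m Q) (y *m Q) = dotv x y.
Proof.
move=> QQ; have E (a b : 'rV[R]_n) : dotv a b = (a *m b^T) 0 0.
  by rewrite !mxE; apply: eq_bigr => i _; rewrite !mxE.
by rewrite !E trmx_mul mulmxA -(mulmxA x) QQ mulmx1.
Qed.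

(** This is |d| <= |a| + mu |d| kept in squares. Expanding |b - mu d|^2 >= 0 gives (b, d) <= mu
    |d|^2, so (a, d) >= (1 - mu) |d|^2, and |a - (1 - mu) d|^2 >= 0 concludes. *)
Lemma contraction_residual n (a b d : 'rV[R]_n) mu : 0 < mu < 1 -> d = a + b ->
  dotv b b <= mu ^+ 2 * dotv d d -> (1 - mu) ^+ 2 * dotv d d <= dotv a a.
Proof.
move=> /andP[mu0 mu1] dE bb.
have H1 : dotv d d <= dotv a d + mu * dotv d d.
  rewrite {1}dE dotvDl lerD2l.
  have := dotv_ge0 (b - mu *: d); rewrite !dotvE (dotvC d b).
  by move: bb mu0; move: (dotv b b) (dotv b d) (dotv d d) => B X D; nra.
have := dotv_ge0 (a - (1 - mu) *: d); rewrite !dotvE (dotvC d a).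
by move: H1 mu1; move: (dotv a a) (dotv a d) (dotv d d) => B X D; nra.
Qed.

Lemma Cs_dotv (V : normedModType R) n k (f g : V -> 'rV[R]_n) U : open U ->
  (forall j, Cs k (fun x => f x 0 j) U) -> (forall j, Cs k (fun x => g x 0 j) U) ->
  Cs k (fun x => dotv (f x) (g x)) U.
Proof. by move=> oU Cf Cg; apply: Cs_sum => // j _; apply: Cs_mul. Qed.

Lemma continuous_from_dist (T : topologicalType) (V : normedModType R)
    (f : T -> V) (g : T -> R) (c : R) p : 0 < c -> g p = 0 ->
  (\forall q \near p, c * `|f q - f p| <= g q) ->
  {for p, continuous g} -> {for p, continuous f}.
Proof.
move=> c0 gp fg cg; apply/cvgrPdist_le => e e0.
have ce : 0 < c * e by rewrite mulr_gt0.
move/cvgrPdist_le : cg => /(_ _ ce); rewrite gp => cg.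
near=> q; rewrite distrC -(ler_pM2l c0).
apply: (@le_trans _ _ (g q)); first by near: q.
by rewrite (le_trans (ler_norm _))// -normrN -sub0r; near: q.
Unshelve. all: by end_near. Qed.

Lemma cvg_mulmx (T : Type) (F : set_system T) (FF : Filter F) a b c
    (M : T -> 'M[R]_(a, b)) (N : T -> 'M[R]_(b, c)) (A : 'M[R]_(a, b)) (B : 'M[R]_(b, c)) :
  (forall i j, M t i j @[t --> F] --> A i j) ->
  (forall i j, N t i j @[t --> F] --> B i j) ->
  forall i j, (M t *m N t) i j @[t --> F] --> (A *m B) i j.
Proof.
move=> MA NB i j; rewrite mxE.
rewrite (_ : (fun t => _) = fun t => \sum_k M t i k * N t k j); last first.
  by apply/funext => t; rewrite mxE.
elim: (index_enum _) => [|k r IH].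
  rewrite big_nil (_ : (fun t => _) = cst 0); first exact: cvg_cst.
  by apply/funext => t; rewrite big_nil.
rewrite big_cons (_ : (fun t => _) = (fun t => M t i k * N t k j) \+ (fun t => \sum_(k <- r) M t i k * N t k j)); last first.
  by apply/funext => t; rewrite big_cons.
by apply: cvgD IH; exact: cvgM.
Qed.

Lemma sphere_compact n : compact (@sphere R n).
Proof.
apply: bounded_closed_compact.
  exists 1; split; first exact: num_real.
  move=> M M1 x /= x1; rewrite [leLHS]/Num.Def.normr/= mx_normrE.
  apply: bigmax_le => [|[i j] _]; first by rewrite (le_trans ler01)// ltW.
  rewrite (le_trans _ (ltW M1))// ord1 -(@ler_pXn2r _ 2) ?nnegrE// expr1n.
  by rewrite real_normK ?num_real// -x1 sqr_coord_le_dotv.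
have -> : @sphere R n = (fun x => dotv x x) @^-1` [set 1] by [].
apply: closed_comp; last exact: closed_eq.
move=> x _; apply: (@Cs_continuous _ _ 0 (fun x => dotv x x) setT) => //.
by apply: Cs_dotv; [exact: openT|move=> j; exact: Cs_coord|move=> j; exact: Cs_coord].
Qed.

Lemma sphere_nonempty n : @sphere R n.+2 !=set0.
Proof. by have [x [x1 _]] := exists_unit_orthogonal (0 : 'rV[R]_n.+2); exists x. Qed.

Variables (n : nat) (h : 'rV[R]_n.+2 -> 'rV[R]_n.+2) (W : set 'rV[R]_n.+2) (mu : R).
Hypotheses (oW : open W) (SW : @sphere _ _ `<=` W)
  (Ch : forall k j, Cs k (fun x => h x 0 j) W)
  (hS : forall x, sphere x -> sphere (h x)) (mu01 : 0 < mu < 1)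
  (hmu : forall x y, sphere x -> sphere y ->
    dotv (h x - h y) (h x - h y) <= mu ^+ 2 * dotv (x - y) (x - y)).

(** The displacement |h(x) Q - x| attains a minimum on the compact sphere. If it were nonzero,
    replacing the minimizer by its image would shrink it by the factor mu. *)
Lemma rotated_fixpoint (Q : 'M[R]_n.+2) : Q *m Q^T = 1%:M ->
  exists2 x, sphere x & x = h x *m Q.
Proof.
move=> QQ; have [mu0 mu1] := andP mu01.
have hQS x : sphere x -> sphere (h x *m Q).
  by move=> Sx; rewrite /sphere /= dotv_mulmx_orthogonal//; exact: hS.
pose f x := dotv (h x *m Q - x) (h x *m Q - x).
have cf : {within @sphere R n.+2, continuous f}.
  apply: continuous_in_subspaceT => x /[!inE] Sx.
  apply: (@Cs_continuous _ _ 0 f W); last exact: SW.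
  have C j : Cs 0 (fun x => (h x *m Q - x) 0 j) W.
    rewrite (_ : (fun x => _) = fun x => (h x *m Q) 0 j + - x 0 j); last first.
      by apply/funext => y; rewrite !mxE.
    apply: Cs_add => //; last by apply: Cs_opp => //; exact: Cs_coord.
    apply: Cs_mulmx => // i k; last exact: Cs_cst.
    by rewrite (ord1 i).
  exact: Cs_dotv.
have [x /[!inE] Sx xmin] := EVT_min_rV (sphere_nonempty n) (@sphere_compact _) cf.
exists x => //; apply/esym/eqP; rewrite -subr_eq0; apply: contraTT isT => x0.
have := xmin (h x *m Q); rewrite inE => /(_ (hQS _ Sx)); rewrite {2}/f.
rewrite /f -mulmxBl dotv_mulmx_orthogonal// => H.
have := le_trans H (hmu (hQS _ Sx) Sx).
rewrite leNgt gtr_pMl ?dotv_gt0//.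
by rewrite expr_lt1 ?(ltW mu0)// mu1.
Qed.

Variables (m : nat) (V : set 'rV[R]_m) (Q : 'rV[R]_m -> 'M[R]_n.+2).
Hypotheses (oV : open V) (CQ : forall k i j, Cs k (fun p => Q p i j) V)
  (QQ : forall p, V p -> Q p *m (Q p)^T = 1%:M).
Variable pi : 'rV[R]_m -> 'rV[R]_n.+2.
Hypotheses (piS : forall p, V p -> sphere (pi p))
  (pi_fix : forall p, V p -> pi p = h (pi p) *m Q p).

(** An entrywise l^1 distance of the rotations: it dominates the action of Q q - Q p on unit
    vectors, and divided by |t| it is controlled by the entries of the difference quotient of Q. *)
Definition entry_dist p q := \sum_i \sum_j `|Q q i j - Q p i j|.

(** Write y - x = h(x) (Q q - Q p) + (h(y) - h(x)) Q q, where the second term is contracted by mu.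
    With x and y arbitrary fixed points, p = q yields uniqueness and p != q the Lipschitz bound. *)
Lemma fixpoint_dist x y p q : V p -> V q -> sphere x -> sphere y ->
  x = h x *m Q p -> y = h y *m Q q ->
  (1 - mu) * `|y - x| <= entry_dist p q.
Proof.
move=> Vp Vq Sx Sy ex ey; have [mu0 mu1] := andP mu01.
pose d := y - x; pose b := (h y - h x) *m Q q; pose a := h x *m (Q q - Q p).
have dE : d = a + b.
  by rewrite /d /a /b {1}ey {1}ex mulmxBl mulmxBr [RHS]addrC addrA subrK.
have bb : dotv b b <= mu ^+ 2 * dotv d d.
  by rewrite /b dotv_mulmx_orthogonal ?QQ//; exact: hmu.
have H2 := contraction_residual mu01 dE bb.
have aj j : `|a 0 j| <= \sum_i `|Q q i j - Q p i j|.
  rewrite /a mxE (le_trans (ler_norm_sum _ _ _))//; apply: ler_sum => i _.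
  rewrite normrM !mxE ler_piMl// -(@ler_pXn2r _ 2) ?nnegrE// expr1n.
  by rewrite real_normK ?num_real// -(hS Sx) sqr_coord_le_dotv.
have Qd0 : 0 <= entry_dist p q by apply: sumr_ge0 => i _; apply: sumr_ge0.
have aQ : dotv a a <= entry_dist p q ^+ 2.
  apply: (@le_trans _ _ (\sum_j `|a 0 j| * entry_dist p q)).
    apply: ler_sum => j _; rewrite -expr2 -(real_normK (num_real _)) expr2.
    rewrite ler_wpM2l// (le_trans (aj j))// /entry_dist exchange_big /=.
    by rewrite [leRHS](bigD1 j)//= lerDl sumr_ge0// => i _; rewrite sumr_ge0.
  rewrite -mulr_suml expr2 ler_wpM2r// /entry_dist exchange_big /=.
  exact: ler_sum.
rewrite -/d [`|d|]/Num.Def.normr/= mx_normrE.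
have mu1' : 0 < 1 - mu by rewrite subr_gt0.
rewrite mulrC -ler_pdivlMr//; apply: bigmax_le => [|[i j] _].
  by rewrite divr_ge0// ltW.
rewrite ler_pdivlMr// (ord1 i) /= mulrC -(@ler_pXn2r _ 2) ?nnegrE// ?mulr_ge0 ?(ltW mu1')//.
rewrite exprMn real_normK ?num_real// (le_trans _ aQ)// (le_trans _ H2)//.
by rewrite ler_wpM2l ?sqr_ge0// sqr_coord_le_dotv.
Qed.

Lemma fixpoint_unique x y p : V p -> sphere x -> sphere y ->
  x = h x *m Q p -> y = h y *m Q p -> x = y.
Proof.
move=> Vp Sx Sy ex ey; have := fixpoint_dist Vp Vp Sx Sy ex ey.
rewrite (_ : entry_dist p p = 0); last first.
  by apply: big1 => i _; apply: big1 => j _; rewrite subrr normr0.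
have [mu0 mu1] := andP mu01.
rewrite pmulr_rle0 ?subr_gt0// normr_le0 subr_eq0 => /eqP ->//.
Qed.

Lemma entry_dist_continuous p q : V q -> {for q, continuous (entry_dist p)}.
Proof.
move=> Vq; apply: (@Cs_continuous _ _ 0 (entry_dist p) V) => //.
apply: Cs_sum => // i _; apply: Cs_sum => // j _ {}q {}Vq.
apply: (@continuous_comp _ _ _ (fun q => Q q i j - Q p i j) (fun x : R => `|x|)).
  apply: (Cs_continuous (k := 0%N) _ Vq).
  exact: (Cs_add oV (CQ 0 i j) (Cs_cst 0 (- Q p i j) V)).
exact: norm_continuous.
Qed.

Lemma entry_distxx p : entry_dist p p = 0.
Proof. by apply: big1 => i _; apply: big1 => j _; rewrite subrr normr0. Qed.

Lemma fixpoint_continuous p : V p -> {for p, continuous pi}.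
Proof.
move=> Vp; have [mu0 mu1] := andP mu01.
have mu1' : 0 < 1 - mu by rewrite subr_gt0.
apply: (continuous_from_dist mu1' (entry_distxx p) _ (entry_dist_continuous Vp)).
have := open_nbhs_nbhs (conj oV Vp); apply: filterS => q Vq.
by apply: fixpoint_dist; rewrite -?pi_fix//; exact: piS.
Qed.

(** The transpose of the usual Jacobian, so that it multiplies row vectors on the right: D_w h = w
    H. *)
Definition jac x := \matrix_(i, j) 'D_(delta_mx 0 i) (fun x => h x 0 j) x.
Definition entry_derive v p := \matrix_(i, j) 'D_v (fun p => Q p i j) p.

Lemma derive_jac x w j : W x -> 'D_w (fun x => h x 0 j) x = (w *m jac x) 0 j.
Proof.
move=> Wx; rewrite (derive_dir_sum oW (Ch 1 j) _ Wx) mxE.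
by apply: eq_bigr => i _; rewrite mxE.
Qed.

(* The difference quotient d of pi along v satisfies d (1 - H Q) = rho Q + h(pi) dQ, where rho
   is the Taylor remainder of h, negligible because pi is Lipschitz. *)
Lemma fixpoint_quotient_cvg p v j : V p ->
  (1%:M - jac (pi p) *m Q p) \in unitmx ->
  (t^-1 *: (pi (t *: v + p) 0 j - pi p 0 j)) @[t --> 0^'] -->
  (h (pi p) *m entry_derive v p *m invmx (1%:M - jac (pi p) *m Q p)) 0 j.
Proof.
move=> Vp Nu; set N := 1%:M - _.
have [mu0 mu1] := andP mu01.
have mu1' : 0 < 1 - mu by rewrite subr_gt0.
pose q (t : R) := t *: v + p.
pose del t := pi (q t) - pi p.
pose rho t := t^-1 *: (h (pi (q t)) - h (pi p) - del t *m jac (pi p)).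
pose dQ t := t^-1 *: (Q (q t) - Q p).
have q0 : q t @[t --> (0 : R)] --> p.
  have : q t @[t --> (0 : R)] --> (0 : R) *: v + p.
    by apply: cvgD; [exact: scalel_continuous|exact: cvg_cst].
  by rewrite scale0r add0r.
have Vq : \forall t \near (0 : R), V (q t).
  by apply: q0; exact: open_nbhs_nbhs.
have pq0 : pi (q t) @[t --> (0 : R)] --> pi p.
  exact: (continuous_cvg _ (fixpoint_continuous Vp) q0).
have dQ_cvg i k : dQ t i k @[t --> 0^'] --> entry_derive v p i k.
  rewrite mxE (_ : (fun t => dQ t i k) = fun t => t^-1 *: (Q (t *: v + p) i k - Q p i k)); last first.
    by apply/funext => t; rewrite !mxE.
  exact: (Cs_derivable (CQ 1 i k) Vp).
have hq_cvg i : h (pi (q t)) 0 i @[t --> 0^'] --> h (pi p) 0 i.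
  have hc : {for pi p, continuous (fun x => h x 0 i)}.
    exact: Cs_continuous (Ch 0 i) (SW (piS Vp)).
  have H : h (pi (q t)) 0 i @[t --> (0 : R)] --> h (pi p) 0 i.
    exact: (continuous_cvg _ hc pq0).
  by move=> A /H; exact: nbhs_dnbhs.
have rho_cvg i : rho t 0 i @[t --> 0^'] --> (0 : 'rV[R]_n.+2) 0 i.
  rewrite mxE; apply/cvgrPdist_le => e e0.
  pose S0 := \sum_k \sum_l (`|entry_derive v p k l| + 1).
  pose S := 1 + S0.
  have S_gt0 : 0 < S.
    rewrite ltr_wpDr//; apply: sumr_ge0 => k _; apply: sumr_ge0 => l _.
    by rewrite addr_ge0.
  (* The Taylor remainder is at most e1 |del t|, with (1 - mu) |del t| <= [entry_dist] <= S0 |t| for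
     small t. This choice of e1 makes it at most e |t|. *)
  pose e1 := e * (1 - mu) / S.
  have e10 : 0 < e1 by rewrite divr_gt0// mulr_gt0.
  have /nbhs_ballP[r /= r0 Hr] := C1_littleo oW (Ch 1 i) (SW (piS Vp)) e10.
  have dQ_near : \forall t \near 0^', forall k l, `|dQ t k l| <= `|entry_derive v p k l| + 1.
    apply: filter_forall => k; apply: filter_forall => l.
    have H : `|entry_derive v p k l| < `|entry_derive v p k l| + 1 by rewrite ltrDl.
    by apply: cvgr_norm_le H; exact: dQ_cvg.
  have del_near : \forall t \near 0^', `|del t| < r.
    apply: nbhs_dnbhs; move/cvgrPdist_lt : pq0 => /(_ _ r0); apply: filterS => t.
    by rewrite distrC.
  have Vq' : \forall t \near 0^', V (q t) by exact: nbhs_dnbhs.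
  near=> t.
  have t0 : t != 0 by near: t; exact: nbhs_dnbhs_neq.
  have Vt : V (q t) by near: t.
  have -> : rho t 0 i = t^-1 * (h (del t + pi p) 0 i -
      (h (pi p) 0 i + 'D_(del t) (fun x => h x 0 i) (pi p))).
    rewrite derive_jac; last exact/SW/piS.
    by rewrite /rho [in RHS]/del subrK !mxE opprD addrA.
  rewrite sub0r normrN.
  rewrite normrM normfV mulrC ler_pdivrMr ?normr_gt0//.
  have Hd : `|h (del t + pi p) 0 i - (h (pi p) 0 i + 'D_(del t) (fun x => h x 0 i) (pi p))|
      <= e1 * `|del t|.
    by apply: Hr; rewrite -ball_normE /ball_ /= sub0r normrN; near: t.
  rewrite (le_trans Hd)// /e1 -!mulrA ler_wpM2l ?(ltW e0)// mulrCA mulrC ler_pdivrMr//.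
  have Hq : (1 - mu) * `|del t| <= entry_dist p (q t).
    by apply: fixpoint_dist; rewrite -?pi_fix//; exact: piS.
  rewrite (le_trans Hq)// (@le_trans _ _ (S0 * `|t|))//; last first.
    by rewrite mulrC ler_wpM2l// /S lerDr.
  rewrite /entry_dist /S0 big_distrl /=; apply: ler_sum => k _.
  rewrite big_distrl /=; apply: ler_sum => l _.
  have : `|dQ t k l| <= `|entry_derive v p k l| + 1 by move: k l; near: t.
  by rewrite /dQ !mxE normrM normfV mulrC ler_pdivrMr ?normr_gt0.
have main : ((rho t *m Q p + h (pi (q t)) *m dQ t) *m invmx N) 0 j @[t --> 0^'] -->
    ((0 *m Q p + h (pi p) *m entry_derive v p) *m invmx N) 0 j.
  apply: cvg_mulmx => [i k|i k]; last exact: cvg_cst.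
  rewrite ord1 [X in _ --> X]mxE.
  rewrite (_ : (fun t => _) = (fun t => (rho t *m Q p) 0 k) \+ (fun t => (h (pi (q t)) *m dQ t) 0 k)); last first.
    by apply/funext => t; rewrite [LHS]mxE.
  apply: cvgD; apply: cvg_mulmx => [? l|? ?]; rewrite ?ord1 //.
  exact: cvg_cst.
move: main; rewrite mul0mx add0r; apply: cvg_trans.
apply: near_eq_cvg; near=> t.
have t0 : t != 0 by near: t; exact: nbhs_dnbhs_neq.
have Vt : V (q t) by near: t; exact: nbhs_dnbhs.
(* An exact identity for each such t: h is taken at the moved point in the term with dQ, so the
   cross terms cancel and [pi_fix] at both p and q t leaves del t minus its linear image. *)
suff -> : rho t *m Q p + h (pi (q t)) *m dQ t = (t^-1 *: del t) *m N.
  by rewrite mulmxK// !mxE.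
rewrite /N mulmxBr mulmx1 /rho /dQ -!scalemxAl -scalemxAr -scalerDr -scalerBr.
congr (_ *: _); rewrite mulmxBl mulmxBl mulmxBr mulmxA -!pi_fix//.
rewrite {2}/del; move: (h _ *m Q p) (del t *m _ *m _) => X Y.
by apply/matrixP => i k; rewrite !mxE; ring.
Unshelve. all: by end_near. Qed.

Lemma fixpoint_derivable p v : V p -> (1%:M - jac (pi p) *m Q p) \in unitmx ->
  derivable pi p v.
Proof.
move=> Vp Nu; apply: derivable_rV => j.
by apply/cvg_ex; eexists; exact: fixpoint_quotient_cvg.
Qed.

Lemma fixpoint_derive p v : V p -> (1%:M - jac (pi p) *m Q p) \in unitmx ->
  'D_v pi p = h (pi p) *m entry_derive v p *m invmx (1%:M - jac (pi p) *m Q p).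
Proof.
move=> Vp Nu; apply/rowP => j; rewrite -derive_rV; last exact: fixpoint_derivable.
by apply: cvg_lim => //; exact: fixpoint_quotient_cvg.
Qed.

Hypothesis unitN : forall p, V p -> (1%:M - jac (pi p) *m Q p) \in unitmx.

(** The formula for D_v pi contains pi only undifferentiated, inside functions smooth to every
    order, so each pass of the induction gains one derivative. *)
Lemma fixpoint_smooth k j : Cs k (fun p => pi p 0 j) V.
Proof.
have cpi i p : V p -> {for p, continuous (fun p => pi p 0 i)}.
  move=> Vp; apply: (@continuous_comp _ _ _ pi (fun y : 'rV[R]_n.+2 => y 0 i)).
    exact: fixpoint_continuous.
  exact: coord_continuous.
have VW p : V p -> W (pi p) by move=> Vp; exact/SW/piS.
elim: k j => [|k IH] j; first by move=> p; exact: cpi.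
have dpi p v : V p -> derivable pi p v.
  by move=> Vp; apply: fixpoint_derivable => //; exact: unitN.
split; first by move=> p; exact: cpi.
split; first by move=> p v Vp; exact: (derivable_mxP _ _ _).1 (dpi p v Vp) 0 j.
move=> v.
have CN i l : Cs k (fun p => (1%:M - jac (pi p) *m Q p) i l) V.
  rewrite (_ : (fun p => _) = fun p => (1%:M : 'M[R]_n.+2) i l + - (jac (pi p) *m Q p) i l); last first.
    by apply/funext => p; rewrite !mxE.
  apply: Cs_add => //; first exact: Cs_cst.
  apply: Cs_opp => //; apply: Cs_mulmx => // a b.
  rewrite (_ : (fun p => _) = 'D_(delta_mx 0 a) (fun x => h x 0 b) \o pi); last first.
    by apply/funext => p; rewrite mxE.
  by apply: (Cs_comp oV oW VW IH); exact: (Cs_derive _ (Ch k.+1 b)).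
have C : Cs k (fun p => (h (pi p) *m entry_derive v p *m invmx (1%:M - jac (pi p) *m Q p)) 0 j) V.
  apply: Cs_mulmx => // [a b|]; last exact: Cs_invmx.
  apply: Cs_mulmx => // [? c|c d].
    rewrite ord1; exact: (Cs_comp oV oW VW IH (Ch k c)).
  rewrite (_ : (fun p => _) = 'D_v (fun p => Q p c d)); last first.
    by apply/funext => p; rewrite mxE.
  exact: (Cs_derive _ (CQ k.+1 c d)).
apply: (Cs_ext oV _ C) => p /[!inE] Vp.
by rewrite derive_rV ?fixpoint_derive//; [exact: unitN|exact: dpi].
Qed.

End FixedPoint.

(** * Quaternions and two-vectors of R^4 *)

Local Notation "x '_[' k ]" := (x (0 : 'I_1) (inord k)) (at level 2, format "x '_[' k ]").

Section Coordinates.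
Variable R : realType.

Definition mkrow n (s : seq R) : 'rV[R]_n.+1 := \row_k nth 0 s k.

Lemma mkrowE n s k : (k <= n)%N -> mkrow n s 0 (inord k) = nth 0 s k.
Proof. by move=> kn; rewrite mxE inordK. Qed.

Lemma eq_row_inord n (x y : 'rV[R]_n.+1) :
  (forall k, (k < n.+1)%N -> x 0 (inord k) = y 0 (inord k)) -> x = y.
Proof. by move=> xy; apply/rowP => k; rewrite -(inord_val k) xy. Qed.

Lemma big_inord n (F : 'I_n.+1 -> R) :
  \sum_(i < n.+1) F i = \sum_(0 <= k < n.+1) F (inord k).
Proof. by rewrite big_mkord; apply: eq_bigr => i _; rewrite inord_val. Qed.

Lemma dotv3 (x y : 'rV[R]_3) : dotv x y = x 0 (inord 0) * y 0 (inord 0) +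
  x 0 (inord 1) * y 0 (inord 1) + x 0 (inord 2) * y 0 (inord 2).
Proof. by rewrite /dotv big_inord unlock /= addr0 !addrA. Qed.

Lemma dotv4 (x y : 'rV[R]_4) : dotv x y = x 0 (inord 0) * y 0 (inord 0) +
  x 0 (inord 1) * y 0 (inord 1) + x 0 (inord 2) * y 0 (inord 2) +
  x 0 (inord 3) * y 0 (inord 3).
Proof. by rewrite /dotv big_inord unlock /= addr0 !addrA. Qed.

Lemma dotv6 (x y : 'rV[R]_6) : dotv x y = x 0 (inord 0) * y 0 (inord 0) +
  x 0 (inord 1) * y 0 (inord 1) + x 0 (inord 2) * y 0 (inord 2) +
  x 0 (inord 3) * y 0 (inord 3) + x 0 (inord 4) * y 0 (inord 4) +
  x 0 (inord 5) * y 0 (inord 5).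
Proof. by rewrite /dotv big_inord unlock /= addr0 !addrA. Qed.


Lemma eq_row3 (x y : 'rV[R]_3) : x _[0] = y _[0] -> x _[1] = y _[1] ->
  x _[2] = y _[2] -> x = y.
Proof. by move=> *; apply: eq_row_inord; case=> [|[|[|]]]. Qed.

Lemma eq_row4 (x y : 'rV[R]_4) : x _[0] = y _[0] -> x _[1] = y _[1] ->
  x _[2] = y _[2] -> x _[3] = y _[3] -> x = y.
Proof. by move=> *; apply: eq_row_inord; case=> [|[|[|[|]]]]. Qed.

Lemma eq_row6 (x y : 'rV[R]_6) : x _[0] = y _[0] -> x _[1] = y _[1] ->
  x _[2] = y _[2] -> x _[3] = y _[3] -> x _[4] = y _[4] -> x _[5] = y _[5] -> x = y.
Proof. by move=> *; apply: eq_row_inord; case=> [|[|[|[|[|[|]]]]]]. Qed.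

(* Coordinates on E_- and E_+ scaled so that unit vectors correspond to S^2_- and S^2_+. *)
Definition embm (a : 'rV[R]_3) : 'rV[R]_6 := 2^-1 *:
  mkrow 5 [:: a _[0]; a _[1]; a _[2]; - a _[2]; a _[1]; - a _[0]].
Definition embp (b : 'rV[R]_3) : 'rV[R]_6 := 2^-1 *:
  mkrow 5 [:: b _[0]; b _[1]; b _[2]; b _[2]; - b _[1]; b _[0]].
(** The anti-self-dual part of w in the coordinates of [embm]; the factor 1/2 of the projection sits
    in [embm]. Likewise [projp] gives the self-dual part. *)
Definition projm (w : 'rV[R]_6) : 'rV[R]_3 :=
  mkrow 2 [:: w _[0] - w _[5]; w _[1] + w _[4]; w _[2] - w _[3]].
Definition projp (w : 'rV[R]_6) : 'rV[R]_3 :=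
  mkrow 2 [:: w _[0] + w _[5]; w _[1] - w _[4]; w _[2] + w _[3]].

(* The quaternion product p a of p in H = R^4 with an imaginary quaternion a. *)
Definition qmulr (p : 'rV[R]_4) (a : 'rV[R]_3) : 'rV[R]_4 := mkrow 3
  [:: - (p _[1] * a _[0] + p _[2] * a _[1] + p _[3] * a _[2]);
      p _[0] * a _[0] + p _[2] * a _[2] - p _[3] * a _[1];
      p _[0] * a _[1] + p _[3] * a _[0] - p _[1] * a _[2];
      p _[0] * a _[2] + p _[1] * a _[1] - p _[2] * a _[0]].

(* The quaternion product b p. *)
Definition qmull (b : 'rV[R]_3) (p : 'rV[R]_4) : 'rV[R]_4 := mkrow 3
  [:: - (p _[1] * b _[0] + p _[2] * b _[1] + p _[3] * b _[2]);
      p _[0] * b _[0] - p _[2] * b _[2] + p _[3] * b _[1];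
      p _[0] * b _[1] - p _[3] * b _[0] + p _[1] * b _[2];
      p _[0] * b _[2] - p _[1] * b _[1] + p _[2] * b _[0]].

(* The imaginary parts of conj(p) z and of z conj(p). *)
Definition qiml (p z : 'rV[R]_4) : 'rV[R]_3 := projm (wedge p z).
Definition qimr (p z : 'rV[R]_4) : 'rV[R]_3 := projp (wedge p z).

Lemma mx_scaleE m n a (x : 'M[R]_(m, n)) i j : (a *: x) i j = a * x i j.
Proof. by rewrite mxE. Qed.
Lemma mx_addE m n (x y : 'M[R]_(m, n)) i j : (x + y) i j = x i j + y i j.
Proof. by rewrite mxE. Qed.
Lemma mx_oppE m n (x : 'M[R]_(m, n)) i j : (- x) i j = - x i j.
Proof. by rewrite mxE. Qed.

Definition coordE := (mx_scaleE, mx_addE, mx_oppE).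

Lemma embmE a : ((embm a) _[0] = a _[0] / 2) * ((embm a) _[1] = a _[1] / 2) *
  ((embm a) _[2] = a _[2] / 2) * ((embm a) _[3] = - a _[2] / 2) *
  ((embm a) _[4] = a _[1] / 2) * ((embm a) _[5] = - a _[0] / 2).
Proof. by do !split; rewrite coordE mkrowE //= mulrC. Qed.

Lemma embpE b : ((embp b) _[0] = b _[0] / 2) * ((embp b) _[1] = b _[1] / 2) *
  ((embp b) _[2] = b _[2] / 2) * ((embp b) _[3] = b _[2] / 2) *
  ((embp b) _[4] = - b _[1] / 2) * ((embp b) _[5] = b _[0] / 2).
Proof. by do !split; rewrite coordE mkrowE //= mulrC. Qed.

Lemma projmE w : ((projm w) _[0] = w _[0] - w _[5]) *
  ((projm w) _[1] = w _[1] + w _[4]) * ((projm w) _[2] = w _[2] - w _[3]).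
Proof. by do !split; rewrite mkrowE. Qed.

Lemma projpE w : ((projp w) _[0] = w _[0] + w _[5]) *
  ((projp w) _[1] = w _[1] - w _[4]) * ((projp w) _[2] = w _[2] + w _[3]).
Proof. by do !split; rewrite mkrowE. Qed.

Lemma qmulrE p a :
  ((qmulr p a) _[0] = - (p _[1] * a _[0] + p _[2] * a _[1] + p _[3] * a _[2])) *
  ((qmulr p a) _[1] = p _[0] * a _[0] + p _[2] * a _[2] - p _[3] * a _[1]) *
  ((qmulr p a) _[2] = p _[0] * a _[1] + p _[3] * a _[0] - p _[1] * a _[2]) *
  ((qmulr p a) _[3] = p _[0] * a _[2] + p _[1] * a _[1] - p _[2] * a _[0]).
Proof. by do !split; rewrite mkrowE. Qed.

Lemma qmullE b p :
  ((qmull b p) _[0] = - (p _[1] * b _[0] + p _[2] * b _[1] + p _[3] * b _[2])) *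
  ((qmull b p) _[1] = p _[0] * b _[0] - p _[2] * b _[2] + p _[3] * b _[1]) *
  ((qmull b p) _[2] = p _[0] * b _[1] - p _[3] * b _[0] + p _[1] * b _[2]) *
  ((qmull b p) _[3] = p _[0] * b _[2] - p _[1] * b _[1] + p _[2] * b _[0]).
Proof. by do !split; rewrite mkrowE. Qed.

Lemma wedge_coords (v w : 'rV[R]_4) :
  ((wedge v w) _[0] = v _[0] * w _[1] - v _[1] * w _[0]) *
  ((wedge v w) _[1] = v _[0] * w _[2] - v _[2] * w _[0]) *
  ((wedge v w) _[2] = v _[0] * w _[3] - v _[3] * w _[0]) *
  ((wedge v w) _[3] = v _[1] * w _[2] - v _[2] * w _[1]) *
  ((wedge v w) _[4] = v _[1] * w _[3] - v _[3] * w _[1]) *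
  ((wedge v w) _[5] = v _[2] * w _[3] - v _[3] * w _[2]).
Proof. by do !split; rewrite mxE /pi1 /pi2 inordK. Qed.

Lemma hodge_coords (w : 'rV[R]_6) : ((hodge w) _[0] = w _[5]) * ((hodge w) _[1] = - w _[4]) *
  ((hodge w) _[2] = w _[3]) * ((hodge w) _[3] = w _[2]) *
  ((hodge w) _[4] = - w _[1]) * ((hodge w) _[5] = w _[0]).
Proof.
have E k : (k < 6)%N -> rev_ord (inord k : 'I_6) = inord (5 - k).
  by move=> k6; apply: val_inj => /=; rewrite !inordK ?ltnS ?leq_subr.
by do !split; rewrite mxE E// /hsign /= !inordK//= ?mul1r ?mulN1r.
Qed.

End Coordinates.

Ltac coords := rewrite /qimr /qiml ?dotv3 ?dotv4 ?dotv6;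
  rewrite ?(coordE, embmE, embpE, projmE, projpE, qmulrE, qmullE, wedge_coords, hodge_coords).
Ltac byrow := first [apply: eq_row3|apply: eq_row4|apply: eq_row6]; coords; try ring.

(** * Quaternion identities and the rotation by conjugation *)

Section Quaternions.
Variable R : realType.
Implicit Types (p z : 'rV[R]_4) (a b : 'rV[R]_3).

Lemma emb_proj (w : 'rV[R]_6) : embm (projm w) + embp (projp w) = w.
Proof. by byrow; lra. Qed.

Lemma projm_emb a b : projm (embm a + embp b) = a.
Proof. by byrow; lra. Qed.
Lemma projp_emb a b : projp (embm a + embp b) = b.
Proof. by byrow; lra. Qed.

Lemma qiml_qmulr p a : qiml p (qmulr p a) = dotv p p *: a.
Proof. by byrow. Qed.
Lemma qimr_qmull p b : qimr p (qmull b p) = dotv p p *: b.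
Proof. by byrow. Qed.
Lemma qmulr_qiml p z : qmulr p (qiml p z) = dotv p p *: z - dotv p z *: p.
Proof. by byrow. Qed.
Lemma qmull_qimr p z : qmull (qimr p z) p = dotv p p *: z - dotv p z *: p.
Proof. by byrow. Qed.
Lemma qmulrA b p a : qmull b (qmulr p a) = qmulr (qmull b p) a.
Proof. by byrow. Qed.
Lemma qmulr_sq p a : qmulr (qmulr p a) a = - dotv a a *: p.
Proof. by byrow. Qed.
Lemma qmull_sq b p : qmull b (qmull b p) = - dotv b b *: p.
Proof. by byrow. Qed.
Lemma qmulrD p q a : qmulr (p + q) a = qmulr p a + qmulr q a.
Proof. by byrow. Qed.
Lemma qmullD b p q : qmull b (p + q) = qmull b p + qmull b q.
Proof. by byrow. Qed.
Lemma qmulrZ c p a : qmulr (c *: p) a = c *: qmulr p a.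
Proof. by byrow. Qed.
Lemma qmullZ c b p : qmull b (c *: p) = c *: qmull b p.
Proof. by byrow. Qed.
Lemma dotv_qmulr p a : dotv (qmulr p a) (qmulr p a) = dotv p p * dotv a a.
Proof. by coords; ring. Qed.
Lemma dotv_qmulr_orth p a : dotv p (qmulr p a) = 0.
Proof. by coords; ring. Qed.

(* The matrix of b |-> conj(p) b p acting on row vectors. *)
Definition rotM (p : 'rV[R]_4) : 'M[R]_3 := \matrix_(i, j) nth 0 (nth [::]
  [:: [:: p _[0] * p _[0] + p _[1] * p _[1] - p _[2] * p _[2] - p _[3] * p _[3];
          2 * (p _[1] * p _[2] - p _[0] * p _[3]); 2 * (p _[1] * p _[3] + p _[0] * p _[2])];
      [:: 2 * (p _[1] * p _[2] + p _[0] * p _[3]);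
          p _[0] * p _[0] - p _[1] * p _[1] + p _[2] * p _[2] - p _[3] * p _[3];
          2 * (p _[2] * p _[3] - p _[0] * p _[1])];
      [:: 2 * (p _[1] * p _[3] - p _[0] * p _[2]); 2 * (p _[2] * p _[3] + p _[0] * p _[1]);
          p _[0] * p _[0] - p _[1] * p _[1] - p _[2] * p _[2] + p _[3] * p _[3]]] i) j.

Lemma rotME p i j : (i < 3)%N -> (j < 3)%N ->
  rotM p (inord i) (inord j) = nth 0 (nth [::]
  [:: [:: p _[0] * p _[0] + p _[1] * p _[1] - p _[2] * p _[2] - p _[3] * p _[3];
          2 * (p _[1] * p _[2] - p _[0] * p _[3]); 2 * (p _[1] * p _[3] + p _[0] * p _[2])];
      [:: 2 * (p _[1] * p _[2] + p _[0] * p _[3]);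
          p _[0] * p _[0] - p _[1] * p _[1] + p _[2] * p _[2] - p _[3] * p _[3];
          2 * (p _[2] * p _[3] - p _[0] * p _[1])];
      [:: 2 * (p _[1] * p _[3] - p _[0] * p _[2]); 2 * (p _[2] * p _[3] + p _[0] * p _[1]);
          p _[0] * p _[0] - p _[1] * p _[1] - p _[2] * p _[2] + p _[3] * p _[3]]] i) j.
Proof. by move=> i3 j3; rewrite mxE !inordK. Qed.

Lemma sum3 (F : 'I_3 -> R) : \sum_i F i = F (inord 0) + F (inord 1) + F (inord 2).
Proof. by rewrite big_inord unlock /= addr0 addrA. Qed.

Lemma ord3_ind (P : 'I_3 -> Prop) :
  P (inord 0) -> P (inord 1) -> P (inord 2) -> forall i, P i.
Proof.
move=> P0 P1 P2 i; rewrite -(inord_val i).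
by case: i => -[|[|[|]]].
Qed.

Lemma mul_rotM b p : b *m rotM p = qiml p (qmull b p).
Proof.
by apply: eq_row3; rewrite mxE sum3 !rotME //=; coords; ring.
Qed.

Lemma rotM_orthogonal p : rotM p *m (rotM p)^T = (dotv p p ^+ 2)%:M.
Proof.
have E i j : (i < 3)%N -> (j < 3)%N -> (rotM p)^T (inord i) (inord j) = rotM p (inord j) (inord i).
  by rewrite mxE.
apply/matrixP; do 2!apply: ord3_ind; rewrite mxE sum3 !E // !rotME // [in RHS]mxE dotv4 -val_eqE /= !inordK //=; ring.
Qed.

(** The matrix of b |-> p^-1 b p, which is orthogonal and smooth for every p != 0 and so extends the
    fixed point problem from S^3 to an open set. *)
Definition Qrot p := (dotv p p)^-1 *: rotM p.

Lemma Qrot_orthogonal p : p != 0 -> Qrot p *m (Qrot p)^T = 1%:M.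
Proof.
move=> p0; have d0 := dotv_gt0 p0.
rewrite /Qrot linearZ /= -scalemxAl -scalemxAr rotM_orthogonal scalerA scale_scalar_mx.
by congr (_%:M); field; rewrite gt_eqF.
Qed.

Lemma Cs_rotM k i j U : open U -> Cs k (fun p => rotM p i j) U.
Proof.
move=> oU; have CX l : Cs k (fun p : 'rV[R]_4 => p _[l]) U by exact: Cs_coord.
have CC c : Cs k (fun p : 'rV[R]_4 => c) U by exact: Cs_cst.
move: i j; do 2!apply: ord3_ind;
  under [X in Cs _ X]eq_fun do rewrite rotME //=;
  repeat first [exact: CX|exact: CC|apply: Cs_add => //|apply: Cs_opp => //|apply: Cs_mul => //].
Qed.

Lemma open_neq0 n : open [set x : 'rV[R]_n | x != 0].
Proof.
rewrite (_ : [set x | _] = (fun x => dotv x x) @^-1` [set t | 0 < t]); last first.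
  apply/seteqP; split=> p /=; first exact: dotv_gt0.
  by apply: contraTneq => ->; rewrite dot0v ltxx.
apply: open_comp; last exact: open_gt.
move=> x _; apply: (@Cs_continuous _ _ 0 (fun x => dotv x x) setT) => //.
by apply: Cs_dotv; [exact: openT|move=> j; exact: Cs_coord|move=> j; exact: Cs_coord].
Qed.

Lemma Cs_Qrot k i j : Cs k (fun p => Qrot p i j) [set p | p != 0].
Proof.
have oU := @open_neq0 4.
rewrite (_ : (fun p => _) = fun p => (dotv p p)^-1 * rotM p i j); last first.
  by apply/funext => p; rewrite mxE.
apply: Cs_mul => //; last exact: Cs_rotM.
apply: Cs_inv => //; first by move=> p /dotv_gt0 d0; rewrite gt_eqF.
by apply: Cs_dotv => // l; exact: Cs_coord.
Qed.

(** Reads a derivative off as the linear coefficient in t; degree 3 is what the retraction [retr]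
    produces along a line. *)
Lemma is_derive_cubic (V : normedModType R) (f : V -> R) (p u : V) (c1 c2 c3 : R) :
  (forall t : R, f (t *: u + p) = f p + t * c1 + t ^+ 2 * (c2 + t * c3)) ->
  is_derive p u f c1.
Proof.
move=> fE.
have H : (fun h : R => h^-1 *: (f (h *: u + p) - f p)) @ 0^' --> c1.
  have H1 : (c1 + h * (c2 + h * c3)) @[h --> 0^'] --> c1.
    have : (c1 + h * (c2 + h * c3)) @[h --> (0 : R)] --> c1 + 0 * (c2 + 0 * c3).
      apply: cvgD; [exact: cvg_cst|apply: cvgM; [exact: cvg_id|]].
      by apply: cvgD; [exact: cvg_cst|apply: cvgM; [exact: cvg_id|exact: cvg_cst]].
    by rewrite mul0r addr0 => H A /H; exact: nbhs_dnbhs.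
  apply: cvg_trans H1; apply: near_eq_cvg; near=> h.
  have h0 : h != 0 by near: h; exact: nbhs_dnbhs_neq.
  by rewrite fE /GRing.scale /=; field.
split; last exact: cvg_lim.
by apply/cvg_ex; exists c1.
Unshelve. all: by end_near. Qed.

(** [rotM] is quadratic in p, and the differential of a quadratic map is its polarization. *)
Lemma is_derive_rotM p u i j :
  is_derive p u (fun p => rotM p i j) ((rotM (p + u) - rotM p - rotM u) i j).
Proof.
apply: (is_derive_cubic (c2 := rotM u i j) (c3 := 0)) => t.
by move: i j; do 2!apply: ord3_ind; rewrite !coordE !rotME //= !coordE; ring.
Qed.

Lemma mul_rotM_polar b p u : b *m (rotM (p + u) - rotM p - rotM u) =
  qiml u (qmull b p) + qiml p (qmull b u).
Proof. by rewrite !mulmxBr !mul_rotM; byrow. Qed.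

(** Along u orthogonal to p the normalizing factor is stationary. The product rule is applied to
    |p|^2 [Qrot] = [rotM]. *)
Lemma derive_Qrot p u i j : dotv p p = 1 -> dotv u p = 0 ->
  'D_u (fun p => Qrot p i j) p = (rotM (p + u) - rotM p - rotM u) i j.
Proof.
move=> p1 up.
have p0 := unit_neq0 p1.
have dd : is_derive p u (fun p => dotv p p) 0.
  apply: (is_derive_cubic (c2 := dotv u u) (c3 := 0)) => t.
  by rewrite !dotvE (dotvC p u) up; ring.
have [dr Dr] := is_derive_rotM p u i j; rewrite -Dr.
have dQ : derivable (fun p => Qrot p i j) p u.
  by apply: (Cs_derivable (Cs_Qrot 1 i j)).
have E : (fun p => dotv p p) \* (fun p => Qrot p i j) = (fun p => rotM p i j).
  (* As an equality of functions this must hold at q = 0 too, where the inverse of 0 is 0 and [rotM]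
     vanishes. *)
  apply/funext => q /=; rewrite mxE mulrA; have [->|q0] := eqVneq q 0.
    by rewrite dot0v invr0 mulr0 mul0r;
    move: i j {dr Dr dQ}; do 2!apply: ord3_ind; rewrite rotME //= !mxE; ring.
  by rewrite divff ?mul1r// gt_eqF// dotv_gt0.
have [dd1 Dd1] := dd.
have := deriveM dd1 dQ; rewrite [X in 'D_u X p](_ : _ = fun p => rotM p i j)// => ->.
by rewrite Dd1 p1 scale1r scaler0 addr0.
Qed.

Definition cross (a c : 'rV[R]_3) : 'rV[R]_3 := mkrow 2
  [:: a _[1] * c _[2] - a _[2] * c _[1]; a _[2] * c _[0] - a _[0] * c _[2];
      a _[0] * c _[1] - a _[1] * c _[0]].

Lemma qiml_commutator p a c : qiml (qmulr p c) (qmulr p a) + qiml p (qmulr (qmulr p a) c)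
  = 2 * dotv p p *: cross a c.
Proof. by apply: eq_row3; rewrite [in RHS]coordE mkrowE //=; coords; ring. Qed.

Lemma cross_cross a w : cross a (cross w a) = dotv a a *: w - dotv a w *: a.
Proof. by apply: eq_row3; rewrite mkrowE //= !mkrowE //=; coords; ring. Qed.

Lemma crossZr a c k : cross a (k *: c) = k *: cross a c.
Proof. by apply: eq_row3; rewrite [in RHS]coordE !mkrowE //=; coords; ring. Qed.

(* The differential of p |-> conj(p) b p along u = p c, with a = conj(p) b p, is the
   commutator a c - c a = 2 a x c; for c = (w x a) / 2 and w orthogonal to a this is w. *)
Lemma Hopf_submersion p a b w : dotv p p = 1 -> dotv a a = 1 -> dotv a w = 0 ->
  qmulr p a = qmull b p ->
  exists2 u, dotv u p = 0 & b *m (rotM (p + u) - rotM p - rotM u) = w.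
Proof.
move=> p1 a1 aw pab; exists (qmulr p (2^-1 *: cross w a)).
  by rewrite dotvC dotv_qmulr_orth.
rewrite mul_rotM_polar qmulrA -pab qiml_commutator p1 crossZr cross_cross a1 aw.
by rewrite scale1r scale0r subr0 scalerA mulr1 divff ?scale1r// pnatr_eq0.
Qed.

End Quaternions.

(** * Oriented planes and complex structures of R^4 *)

Section Geometry.
Variable R : realType.
Implicit Types (p z : 'rV[R]_4) (a b : 'rV[R]_3) (w : 'rV[R]_6).

Lemma eq_coord n (x y : 'rV[R]_n.+1) k : x = y -> x _[k] = y _[k].
Proof. by move=> ->. Qed.

Lemma dotv_embm a b : dotv (embm a) (embm b) = dotv a b / 2.
Proof. by coords; field. Qed.
Lemma dotv_embp a b : dotv (embp a) (embp b) = dotv a b / 2.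
Proof. by coords; field. Qed.
Lemma dotv_qmull_orth p b : dotv p (qmull b p) = 0.
Proof. by coords; ring. Qed.

Lemma Eminus_embm a : Eminus (embm a).
Proof. by rewrite /Eminus /=; byrow. Qed.
Lemma Eminus_projm w : Eminus w -> w = embm (projm w).
Proof.
move=> E; have := eq_coord 0 E; have := eq_coord 1 E.
have := eq_coord 2 E; coords => h2 h1 h0.
by byrow; lra.
Qed.
Lemma Eplus_projp w : Eplus w -> w = embp (projp w).
Proof.
move=> E; have := eq_coord 0 E; have := eq_coord 1 E.
have := eq_coord 2 E; coords => h2 h1 h0.
by byrow; lra.
Qed.

Lemma S2minus_embm a : S2minus (embm a) <-> sphere a.
Proof.
rewrite /S2minus /sphere /= dotv_embm; split=> [[_]|->]; first by lra.
by split => //; exact: Eminus_embm.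
Qed.
Lemma S2minusP w : S2minus w -> exists2 a, sphere a & w = embm a.
Proof.
move=> Sw; have [/Eminus_projm E _] := Sw; exists (projm w) => //.
by apply/S2minus_embm; rewrite -E.
Qed.
Lemma wedge_unit p a b : dotv p p = 1 -> qmulr p a = qmull b p ->
  wedge p (qmulr p a) = embm a + embp b.
Proof.
move=> p1 pab; rewrite -[LHS]emb_proj -/(qiml _ _) -/(qimr _ _) qiml_qmulr.
by rewrite pab qimr_qmull p1 !scale1r.
Qed.

(** If p lies in the plane, the unit vector z completing p to an oriented orthonormal basis
    satisfies p ^ z = a + b. Its anti-self-dual part says z = p a and its self-dual part z = b p.
    Conversely (p, p a) is such a basis. *)
Lemma plane_memP p a b : dotv p p = 1 -> sphere a ->
  plane_mem (embm a + embp b) p <-> qmulr p a = qmull b p.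
Proof.
move=> p1 a1; split=> [[v1 [v2 [[v11 [v21 v12]] [vw [s [t ep]]]]]]|pab].
  pose z := - t *: v1 + s *: v2.
  have st : s * s + t * t = 1.
    by rewrite -p1 ep !dotvE v11 v21 (dotvC v2) v12; ring.
  have wz : wedge p z = embm a + embp b.
    rewrite -vw -[RHS]scale1r -st /z ep; byrow.
  have z0 : dotv p z = 0 by rewrite /z ep !dotvE v11 v21 (dotvC v2) v12; ring.
  have -> : a = qiml p z by rewrite /qiml wz projm_emb.
  have -> : b = qimr p z by rewrite /qimr wz projp_emb.
  by rewrite qmulr_qiml qmull_qimr.
exists p, (qmulr p a); split; last split; first split.
- by [].
- by rewrite dotv_qmulr_orth dotv_qmulr p1 a1 mulr1.
- exact: wedge_unit.
- by exists 1, 0; rewrite scale1r scale0r addr0.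
Qed.

(* p = q a + b q satisfies p a = b p for every q, and the squared norms of these
   vectors for q = 1, i, j, k add up to 8. *)
Lemma exists_intertwiner a b : sphere a -> sphere b ->
  exists2 p, dotv p p = 1 & qmulr p a = qmull b p.
Proof.
rewrite /sphere /= => a1 b1.
pose P q := qmulr q a + qmull b q.
have PE q : qmulr (P q) a = qmull b (P q).
  by rewrite /P qmulrD qmullD qmulr_sq qmull_sq a1 b1 qmulrA addrC.
pose e k : 'rV[R]_4 := delta_mx 0 (inord k).
have eE k l : (k < 4)%N -> (l < 4)%N -> (e k) _[l] = (k == l)%:R.
  by move=> k4 l4; rewrite !mxE eqxx /= -val_eqE /= !inordK// eq_sym.
have sum8 : dotv (P (e 0)) (P (e 0)) + dotv (P (e 1)) (P (e 1)) +
    dotv (P (e 2)) (P (e 2)) + dotv (P (e 3)) (P (e 3)) = 8.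
  move: a1 b1; rewrite /P; coords; rewrite !eE //= => a1 b1.
  rewrite [LHS](_ : _ = 4 * (dotv a a + dotv b b)); last by coords; ring.
  by coords; rewrite a1 b1; ring.
have [q Pq] : exists q, P q != 0.
  have [P0|] := eqVneq (P (e 0)) 0; last by exists (e 0).
  have [P1|] := eqVneq (P (e 1)) 0; last by exists (e 1).
  have [P2|] := eqVneq (P (e 2)) 0; last by exists (e 2).
  have [P3|] := eqVneq (P (e 3)) 0; last by exists (e 3).
  by move: sum8; rewrite P0 P1 P2 P3 !dot0v => /eqP; rewrite !addr0 eq_sym pnatr_eq0.
exists ((Num.sqrt (dotv (P q) (P q)))^-1 *: P q); first exact: unit_normalize.
by rewrite qmulrZ qmullZ PE.
Qed.

(** The matrix of p |-> b p on row vectors, which is the complex structure of the Hopf field when g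
    is constant. *)
Definition lmatrix b : 'M[R]_4 := \matrix_(i, j) nth 0 (nth [::]
  [:: [:: 0; b _[0]; b _[1]; b _[2]]; [:: - b _[0]; 0; b _[2]; - b _[1]];
      [:: - b _[1]; - b _[2]; 0; b _[0]]; [:: - b _[2]; b _[1]; - b _[0]; 0]] i) j.

Lemma ord4_ind (P : 'I_4 -> Prop) :
  P (inord 0) -> P (inord 1) -> P (inord 2) -> P (inord 3) -> forall i, P i.
Proof. by move=> P0 P1 P2 P3 i; rewrite -(inord_val i); case: i => -[|[|[|[|]]]]. Qed.

Lemma sum4 (F : 'I_4 -> R) : \sum_i F i = F (inord 0) + F (inord 1) + F (inord 2) + F (inord 3).
Proof. by rewrite big_inord unlock /= addr0 !addrA. Qed.

Lemma mul_lmatrix b p : p *m lmatrix b = qmull b p.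
Proof. by apply: eq_row4; rewrite mxE sum4 qmullE !mxE !inordK //=; ring. Qed.

Lemma mulmx_row_inj n (A B : 'M[R]_n) : (forall x : 'rV_n, x *m A = x *m B) -> A = B.
Proof. by move=> AB; apply/row_matrixP => i; rewrite !rowE AB. Qed.

Lemma lmatrix_sq b : sphere b -> lmatrix b *m lmatrix b = - 1%:M.
Proof.
move=> b1; apply: mulmx_row_inj => x; rewrite mulmxA !mul_lmatrix qmull_sq b1.
by rewrite mulmxN mulmx1 scaleN1r.
Qed.

Lemma lmatrix_tr b : (lmatrix b)^T = - lmatrix b.
Proof.
by apply/matrixP; do 2!apply: ord4_ind; rewrite !mxE !inordK //= ?opprK ?oppr0.
Qed.

(** The splitting so(4) = so(3) + so(3): reading J as a 2-vector, a and b are halves of its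
    anti-self-dual and self-dual parts. *)
Lemma skew_decomp (J : 'M[R]_4) : J^T = - J ->
  exists a b, forall p, p *m J = qmulr p a + qmull b p.
Proof.
move=> JT; have E i j : J (inord j) (inord i) = - J (inord i) (inord j).
  by have := congr1 (fun M : 'M[R]_4 => M (inord i) (inord j)) JT; rewrite !mxE.
pose j i k := J (inord i) (inord k).
exists (2^-1 *: mkrow 2 [:: j 0%N 1%N - j 2%N 3%N; j 0%N 2%N + j 1%N 3%N; j 0%N 3%N - j 1%N 2%N]).
exists (2^-1 *: mkrow 2 [:: j 0%N 1%N + j 2%N 3%N; j 0%N 2%N - j 1%N 3%N; j 0%N 3%N + j 1%N 2%N]).
move=> p; have D i : J (inord i) (inord i) = 0 by have := E i i; lra.
have := E 0%N 1%N; have := E 0%N 2%N; have := E 0%N 3%N; have := E 1%N 2%N; have := E 1%N 3%N; have := E 2%N 3%N.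
rewrite /j => h23 h13 h12 h03 h02 h01.
by apply: eq_row4; rewrite [LHS]mxE sum4; coords; rewrite ?coordE !mkrowE //= ?D
  ?h23 ?h13 ?h12 ?h03 ?h02 ?h01; lra.
Qed.

(* A complex structure is left or right multiplication: the cross term b p a of its square
   is a scalar map, whose trace vanishes. *)
Lemma complex_structure_decomp (J : 'M[R]_4) : J^T *m J = 1%:M -> J *m J = - 1%:M ->
  (exists a, forall p, p *m J = qmulr p a) \/ (exists b, forall p, p *m J = qmull b p).
Proof.
move=> JTJ JJ.
have JT : J^T = - J.
  by rewrite -[LHS]mulmx1 -[1%:M]opprK -JJ mulmxN mulmxA JTJ mul1mx.
have [a [b Jab]] := skew_decomp JT.
pose k := dotv a a + dotv b b - 1.
have bpa p : 2 *: qmull b (qmulr p a) = k *: p.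
  have : p *m J *m J = - p by rewrite -mulmxA JJ mulmxN mulmx1.
  rewrite !Jab qmulrD qmullD qmulr_sq qmull_sq -qmulrA => /rowP H.
  by apply/rowP => i; have := H i; rewrite !mxE /k; lra.
pose e l : 'rV[R]_4 := delta_mx 0 (inord l).
have eE m l : (m < 4)%N -> (l < 4)%N -> (e m) _[l] = (m == l)%:R.
  by move=> k4 l4; rewrite !mxE eqxx /= -val_eqE /= !inordK// eq_sym.
have H l : (l < 4)%N -> 2 * (qmull b (qmulr (e l) a)) _[l] = k.
  move=> l4; have := eq_coord l (bpa (e l)).
  by rewrite !mx_scaleE eE// eqxx mulr1.
have k0 : k = 0.
  have := H 0 isT; have := H 1 isT; have := H 2 isT; have := H 3 isT.
  by coords; rewrite !eE //=; lra.
(* Now b p a = 0 for p = 1, while the norm of b p a is |a| |b| |p|, so one of a, b vanishes. *)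
have ab0 : dotv a a * dotv b b = 0.
  have z0 : qmull b (qmulr (e 0) a) = 0.
    apply/rowP => i; have := congr1 (fun x : 'rV[R]_4 => x 0 i) (bpa (e 0)).
    by rewrite k0 !mxE mul0r => /eqP; rewrite mulf_eq0 pnatr_eq0 /= => /eqP.
  have : dotv (qmull b (qmulr (e 0) a)) (qmull b (qmulr (e 0) a)) = 0 by rewrite z0 dot0v.
  by coords; rewrite !eE //= => <-; ring.
move/eqP : ab0; rewrite mulf_eq0 => /orP[|] /eqP /dotv_eq0 E0; [right; exists b|left; exists a].
  by move=> p; rewrite Jab E0; byrow; rewrite !mxE; ring.
by move=> p; rewrite Jab E0; byrow; rewrite !mxE; ring.
Qed.

End Geometry.

(** * The great circle fibration *)

Section Main.
Variable R : realType.

Lemma ord6_ind (P : 'I_6 -> Prop) : P (inord 0) -> P (inord 1) -> P (inord 2) ->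
  P (inord 3) -> P (inord 4) -> P (inord 5) -> forall i, P i.
Proof.
move=> P0 P1 P2 P3 P4 P5 i; rewrite -(inord_val i).
by case: i => -[|[|[|[|[|[|]]]]]].
Qed.

Lemma is_derive_additive (V : normedModType R) n (L : V -> 'rV[R]_n) x w j :
  (forall (t : R) y z, L (t *: y + z) = t *: L y + L z) ->
  is_derive x w (fun x => L x 0 j) (L w 0 j).
Proof.
move=> LE; apply: (is_derive_cubic (c2 := 0) (c3 := 0)) => t.
by rewrite LE !coordE; ring.
Qed.

Lemma derive_additive (V : normedModType R) n (L : V -> 'rV[R]_n) x w :
  (forall (t : R) y z, L (t *: y + z) = t *: L y + L z) -> 'D_w L x = L w.
Proof.
move=> LE; have d j := is_derive_additive x w j LE.
have dL : derivable L x w by apply: derivable_rV => j; case: (d j).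
by apply/rowP => j; rewrite -(derive_rV _ dL); case: (d j).
Qed.

Lemma embmP t (y z : 'rV[R]_3) : embm (t *: y + z) = t *: embm y + embm z.
Proof. by apply: eq_row6; coords; ring. Qed.

Lemma projpP t (y z : 'rV[R]_6) : projp (t *: y + z) = t *: projp y + projp z.
Proof. by apply: eq_row3; coords; ring. Qed.

Lemma embm0 : embm 0 = 0 :> 'rV[R]_6.
Proof. by have := embmP (-1) 0 0; rewrite scaler0 addr0 scaleN1r addNr. Qed.

Lemma projp0 : projp 0 = 0 :> 'rV[R]_3.
Proof. by have := projpP (-1) 0 0; rewrite scaler0 addr0 scaleN1r addNr. Qed.

Ltac Cs_poly := repeat first [exact: Cs_coord|exact: Cs_cst|assumption
  |apply: Cs_add => //|apply: Cs_opp => //|apply: Cs_mul => //].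

Lemma Cs_embm k j (U : set 'rV[R]_3) : open U -> Cs k (fun a => embm a 0 j) U.
Proof.
move=> oU; move: j; apply: ord6_ind;
  (under [X in Cs _ X]eq_fun do rewrite ?embmE); Cs_poly.
Qed.

Lemma Cs_projp k j (U : set 'rV[R]_6) : open U -> Cs k (fun a => projp a 0 j) U.
Proof.
move=> oU; move: j; apply: ord3_ind;
  (under [X in Cs _ X]eq_fun do rewrite ?projpE); Cs_poly.
Qed.

Lemma Cs_qmulr (V : normedModType R) (f : V -> 'rV[R]_4) (h : V -> 'rV[R]_3) k j U :
  open U -> (forall j, Cs k (fun x => f x 0 j) U) -> (forall j, Cs k (fun x => h x 0 j) U) ->
  Cs k (fun x => qmulr (f x) (h x) 0 j) U.
Proof.
move=> oU Cf Ch; move: j; apply: ord4_ind;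
  (under [X in Cs _ X]eq_fun do rewrite ?qmulrE);
  repeat first [exact: Cf|exact: Ch|apply: Cs_add => //|apply: Cs_opp => //|apply: Cs_mul => //].
Qed.

Lemma derive_comp_vec (V : normedModType R) n m (phi : V -> 'rV[R]_n)
    (F : 'rV[R]_n -> 'rV[R]_m) (U : set 'rV[R]_n) p v :
  open U -> (forall j, Cs 1 (fun x => F x 0 j) U) -> U (phi p) -> derivable phi p v ->
  is_derive p v (F \o phi) ('D_('D_v phi p) F (phi p)).
Proof.
move=> oU CF Up dphi.
have dF w : derivable F (phi p) w.
  by apply: derivable_rV => j; exact: Cs_derivable (CF j) Up.
have d j := is_derive_comp_C1 oU (CF j) Up dphi.
have dd : derivable (F \o phi) p v by apply: derivable_rV => j; case: (d j).
split; first exact: dd.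
apply/rowP => j; rewrite -(derive_rV _ dd) -(derive_rV _ (dF _)).
by have [_ <-] := d j.
Qed.

(* Equals x on the unit sphere, where its differential is the tangential projection. *)
Definition retr (x : 'rV[R]_3) : 'rV[R]_3 := ((3 - dotv x x) / 2) *: x.

Lemma retr_sphere x : sphere x -> retr x = x.
Proof. by rewrite /sphere /retr /= => ->; rewrite (_ : _ / 2 = 1) ?scale1r//; field. Qed.

Lemma Cs_retr k j U : open U -> Cs k (fun x => retr x 0 j) U.
Proof.
move=> oU; under [X in Cs _ X]eq_fun do rewrite mxE.
have C : Cs k (fun x : 'rV[R]_3 => dotv x x) U.
  by apply: Cs_dotv => // l; exact: Cs_coord.
Cs_poly.
Qed.

(** On rays [retr] is r |-> r (3 - r^2) / 2, which has value 1 and derivative 0 at r = 1. *)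
Lemma is_derive_retr x v : sphere x -> is_derive x v retr (v - dotv x v *: x).
Proof.
move=> x1.
have d j : is_derive x v (fun x => retr x 0 j) ((v - dotv x v *: x) 0 j).
  apply: (is_derive_cubic (c2 := - dotv x v * v 0 j - dotv v v / 2 * x 0 j)
                          (c3 := - dotv v v / 2 * v 0 j)) => t.
  by rewrite /retr !dotvE (dotvC v x) x1 !mxE; field.
have dr : derivable retr x v by apply: derivable_rV => j; case: (d j).
by split => //; apply/rowP => j; rewrite -(derive_rV _ dr); case: (d j).
Qed.

(** * The length decreasing map in ambient coordinates *)

Section Extension.
Variables (U : set 'rV[R]_6) (G : 'rV[R]_6 -> 'rV[R]_6).
Hypotheses (S2U : @S2minus R `<=` U) (Gsm : smooth_on G U)
  (Gmaps : forall x, S2minus x -> S2plus (G x))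
  (Gdecr : forall x w, S2minus x -> Eminus w -> dotv w x = 0 -> w != 0 ->
         dotv (derive G x w) (derive G x w) < dotv w w).

(* The map g in the coordinates embm and embp, extended off the sphere. *)
Definition hmap (a : 'rV[R]_3) : 'rV[R]_3 := projp (G (embm (retr a))).
Definition hdom : set 'rV[R]_3 := [set a | U (embm (retr a))].

Lemma CG k j : Cs k (fun x => G x 0 j) U.
Proof. by case: Gsm => oU /(_ k); move/(Ck_Cs k G oU). Qed.

Lemma Cs_embm_retr k j (W : set 'rV[R]_3) : open W -> Cs k (fun a => embm (retr a) 0 j) W.
Proof.
move=> oW; apply: (Cs_comp (phi := retr) (F := fun a => embm a 0 j) oW openT) => //.
  by move=> i; exact: Cs_retr.
by apply: Cs_embm; exact: openT.
Qed.

Lemma open_hdom : open hdom.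
Proof.
have [oU _] := Gsm; apply: open_comp => // x _; apply: continuous_rV => j.
exact: (Cs_continuous (Cs_embm_retr 0 j openT)).
Qed.

Lemma sphere_hdom : @sphere R 3 `<=` hdom.
Proof. by move=> x Sx; rewrite /hdom /= retr_sphere//; apply/S2U/S2minus_embm. Qed.

Lemma Cs_hmap k j : Cs k (fun a => hmap a 0 j) hdom.
Proof.
have [oU _] := Gsm.
apply: (Cs_comp (phi := fun a => G (embm (retr a))) (F := fun a => projp a 0 j) open_hdom openT) => //.
  move=> i; apply: (Cs_comp (phi := fun a => embm (retr a)) (F := fun a => G a 0 i) open_hdom oU) => //.
    by move=> l; apply: Cs_embm_retr; exact: open_hdom.
  exact: CG.
by apply: Cs_projp; exact: openT.
Qed.

Lemma embp_hmap a : sphere a -> embp (hmap a) = G (embm a).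
Proof.
move=> Sa; rewrite /hmap retr_sphere//.
have /Gmaps[/Eplus_projp <- //] : S2minus (embm a) by apply/S2minus_embm.
Qed.

Lemma hmap_sphere a : sphere a -> sphere (hmap a).
Proof.
move=> Sa; have /Gmaps[_] : S2minus (embm a) by apply/S2minus_embm.
by rewrite -embp_hmap// dotv_embp /sphere /=; lra.
Qed.

Lemma derive_hmap a v : sphere a ->
  'D_v hmap a = projp ('D_(embm (v - dotv a v *: a)) G (embm a)).
Proof.
move=> Sa; have [oU _] := Gsm.
have Ua : U (embm (retr a)) by exact: sphere_hdom.
have [d1 D1] := is_derive_retr v Sa.
have [d2 D2] := derive_comp_vec (F := @embm R) (U := setT) openT
  (fun j => Cs_embm 1 j openT) I d1.
have [d3 D3] := derive_comp_vec (phi := @embm R \o retr) (F := G) oU (CG 1) Ua d2.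
have [d4 D4] := derive_comp_vec (phi := G \o (@embm R \o retr)) (F := @projp R) (U := setT) openT
  (fun j => Cs_projp 1 j openT) I d3.
rewrite [LHS]D4 (derive_additive _ _ projpP) D3 D2 (derive_additive _ _ embmP).
by rewrite D1 /= retr_sphere.
Qed.

(** Adding the squared norm of [projm w] gives equality. The factor 2 cancels the 1/2 of [dotv_embm]
    in [hmap_decr]. *)
Lemma dotv_projp_le w : dotv (projp w) (projp w) <= 2 * dotv w w :> R.
Proof.
coords.
have := sqr_ge0 (w _[0] - w _[5]); have := sqr_ge0 (w _[1] + w _[4]).
have := sqr_ge0 (w _[2] - w _[3]); rewrite !expr2; lra.
Qed.

(** The differential sees only the tangential part v' of v. If v' = 0 it vanishes, otherwise the
    hypothesis on G applies to v' and |v'| <= |v|. *)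
Lemma hmap_decr a v : sphere a -> v != 0 ->
  dotv ('D_v hmap a) ('D_v hmap a) < dotv v v.
Proof.
move=> Sa v0; rewrite derive_hmap//; set v' := v - _.
have vv' : dotv v' v' = dotv v v - dotv a v ^+ 2.
  by rewrite /v' !dotvE (dotvC v a) Sa; ring.
have [v'0|v'0] := eqVneq v' 0.
  by rewrite v'0 embm0 derive0 projp0 dot0v dotv_gt0.
rewrite (le_lt_trans (dotv_projp_le _))//.
apply: (@lt_le_trans _ _ (dotv v' v')); last by rewrite vv' gerBl sqr_ge0.
have : dotv ('D_(embm v') G (embm a)) ('D_(embm v') G (embm a)) < dotv (embm v') (embm v').
  apply: Gdecr; [exact/S2minus_embm|exact: Eminus_embm| |].
    by rewrite dotv_embm /v' !dotvE (dotvC v a) Sa; ring.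
  apply: contra_neq v'0 => e0; apply: dotv_eq0.
  by have := dotv_embm v' v'; rewrite e0 dot0v; lra.
by rewrite dotv_embm; lra.
Qed.

Lemma derive_hmap_jac x w : sphere x -> 'D_w hmap x = w *m jac hmap x.
Proof.
move=> Sx; have dx : derivable hmap x w.
  by apply: derivable_rV => j; exact: Cs_derivable (Cs_hmap 1 j) (sphere_hdom Sx).
apply/rowP => j; rewrite -(derive_rV _ dx).
by rewrite (derive_jac open_hdom (Cs_hmap) _ _ (sphere_hdom Sx)).
Qed.

Lemma hmap_uniform : exists2 l, 0 < l < 1 & forall x w, sphere x ->
  dotv ('D_w hmap x) ('D_w hmap x) <= l ^+ 2 * dotv w w.
Proof.
(* Written with the Jacobian matrix the quantity is jointly continuous in the point and the
   direction, hence has a maximum over pairs of unit vectors; other directions follow by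
   homogeneity. *)
pose f (z : 'rV[R]_3 * 'rV[R]_3) := dotv (z.2 *m jac hmap z.1) (z.2 *m jac hmap z.1).
have fE x w : sphere x -> f (x, w) = dotv ('D_w hmap x) ('D_w hmap x).
  by move=> Sx; rewrite derive_hmap_jac.
have SS0 : (@sphere R 3 `*` @sphere R 3) !=set0.
  by have [x Sx] := sphere_nonempty R 1; exists (x, x).
have SSc : compact (@sphere R 3 `*` @sphere R 3).
  by apply: compact_setX; exact: sphere_compact.
have cf : {within @sphere R 3 `*` @sphere R 3, continuous f}.
  apply: continuous_in_subspaceT => -[x w] /[!inE] -[/= Sx Sw].
  pose W := (@fst 'rV[R]_3 'rV[R]_3) @^-1` hdom.
  have oW : open W by apply: open_comp; [move=> z _; exact: cvg_fst|exact: open_hdom].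
  have C j : Cs 0 (fun z : 'rV[R]_3 * 'rV[R]_3 => (z.2 *m jac hmap z.1) 0 j) W.
    apply: Cs_mulmx => // [i l|i l] z Wz.
      apply: (@continuous_comp _ _ _ snd (fun y : 'rV[R]_3 => y i l)); last exact: coord_continuous.
      exact: cvg_snd.
    rewrite (_ : (fun z => _) = 'D_(delta_mx 0 i) (fun x => hmap x 0 l) \o fst); last first.
      by apply/funext => q; rewrite mxE.
    apply: continuous_comp; first exact: cvg_fst.
    exact: (Cs_continuous (Cs_derive (delta_mx 0 i) (Cs_hmap 1 l)) Wz).
  apply: (@Cs_continuous _ _ 0 f W); last exact: sphere_hdom.
  exact: Cs_dotv.
have [[x w] /[!inE] -[/= Sx Sw] M] := compact_EVT_max SS0 SSc cf.
have w0 := unit_neq0 Sw.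
have M1 : f (x, w) < 1 by rewrite fE// -Sw hmap_decr.
(* The maximum of f is 0 for constant g, whereas [sphere_contraction] asks for l > 0; any positive
   number below 1 would do for 1/4. *)
pose m := Num.max (f (x, w)) (1 / 4).
have m0 : 0 < m by rewrite lt_max [X in _ || X](_ : _ = true) ?orbT//; lra.
have m1 : m < 1 by rewrite gt_max M1 /=; lra.
exists (Num.sqrt m).
  by rewrite sqrtr_gt0 m0 /= -sqrtr1 ltr_sqrt.
move=> y v Sy; rewrite sqr_sqrtr ?(ltW m0)//.
have [->|v0] := eqVneq v 0; first by rewrite derive0 !dot0v mulr0.
pose c := (Num.sqrt (dotv v v))^-1.
have := M (y, c *: v); rewrite inE => /(_ (conj Sy (unit_normalize v0))).
rewrite -fE// /f /= -scalemxAl dotvZl dotvZr mulrA -expr2 exprVn sqr_sqrtr ?dotv_ge0//.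
have vv := dotv_gt0 v0.
rewrite ler_pdivrMl// mulrC => H; rewrite (le_trans H)//.
by rewrite ler_wpM2r ?(ltW vv)// le_max lexx.
Qed.
Lemma hmap_tangent a w : sphere a -> dotv a w = 0 -> dotv (hmap a) ('D_w hmap a) = 0.
Proof.
move=> Sa aw; have [->|w0] := eqVneq w 0; first by rewrite derive0 dotvC dot0v.
have ww := dotv_gt0 w0; pose c := (Num.sqrt (dotv w w))^-1.
have acw : dotv a (c *: w) = 0 by rewrite dotvZr aw mulr0.
have [_ _ _] := great_circle_derive open_hdom sphere_hdom (Cs_hmap 1) hmap_sphere
  0 Sa (unit_normalize w0) acw.
rewrite cos0 sin0 oppr0 !scale0r !scale1r addr0 add0r !derive_hmap_jac// -scalemxAl dotvZr.
by move/eqP; rewrite mulf_eq0 invr_eq0 gt_eqF ?sqrtr_gt0//= => /eqP.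
Qed.

Lemma fibration_exists : exists pi : 'rV[R]_4 -> 'rV[R]_3,
  [/\ (forall k j, Cs k (fun p => pi p 0 j) [set p | p != 0]),
      (forall p, p != 0 -> sphere (pi p)),
      (forall p, dotv p p = 1 -> qmulr p (pi p) = qmull (hmap (pi p)) p),
      (forall p a, dotv p p = 1 -> sphere a -> qmulr p a = qmull (hmap a) p -> pi p = a) &
      (forall p w, dotv p p = 1 -> dotv (pi p) w = 0 ->
         exists2 u, dotv u p = 0 & 'D_u pi p = w)].
Proof.
have [l /andP[l0 l1] hl] := hmap_uniform.
have [mu mu01 hmu] := sphere_contraction open_hdom sphere_hdom (Cs_hmap 1) hmap_sphere l0 l1 hl.
pose V := [set p : 'rV[R]_4 | p != 0].
(* The condition V p sits under the existential so that choice yields a total function, with value 0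
   at p = 0. *)
have ex p : exists x, V p -> sphere x /\ x = hmap x *m Qrot p.
  have [p0|/negP np] := boolP (p != 0); last by exists 0 => /np.
  have [x Sx Ex] := rotated_fixpoint open_hdom sphere_hdom Cs_hmap hmap_sphere mu01 hmu
    (Qrot_orthogonal p0).
  by exists x.
have [pi Hpi] := choice ex; exists pi.
have oV : open V := @open_neq0 R 4.
have CQ k i j : Cs k (fun p => Qrot p i j) V := @Cs_Qrot R k i j.
have QQ p : V p -> Qrot p *m (Qrot p)^T = 1%:M := @Qrot_orthogonal R p.
have piS p : V p -> sphere (pi p) by case/Hpi.
have pi_fix p : V p -> pi p = hmap (pi p) *m Qrot p by case/Hpi.
(* A vector v != 0 in the kernel would equal its image under the differential followed by a
   rotation, which is strictly shorter. *)
have unitN p : V p -> (1%:M - jac hmap (pi p) *m Qrot p) \in unitmx.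
  move=> Vp; rewrite unitmxE unitfE; apply/negP => /det0P[v v0].
  rewrite mulmxBr mulmx1 mulmxA => /subr0_eq E.
  have := hmap_decr (piS _ Vp) v0; rewrite derive_hmap_jac; last exact: piS.
  by rewrite {3 4}E (dotv_mulmx_orthogonal _ _ (QQ _ Vp)) ltxx.
have fixE p a : dotv p p = 1 -> qmulr p a = qmull (hmap a) p <-> a = hmap a *m Qrot p.
  move=> p1; rewrite /Qrot p1 invr1 scale1r mul_rotM; split=> [<-|aE].
    by rewrite qiml_qmulr p1 scale1r.
  by rewrite {1}aE qmulr_qiml p1 dotv_qmull_orth scale1r scale0r subr0.
split.
- move=> k j; exact: (fixpoint_smooth open_hdom sphere_hdom Cs_hmap hmap_sphere mu01 hmu oV CQ QQ piS pi_fix unitN).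
- exact: piS.
- by move=> p p1; apply/fixE => //; apply/pi_fix/unit_neq0.
- move=> p a p1 Sa /(fixE _ _ p1) aE; have Vp : V p := unit_neq0 p1.
  exact: (fixpoint_unique hmap_sphere mu01 hmu QQ Vp (piS _ Vp) Sa (pi_fix _ Vp) aE).
- move=> p w p1 aw; have Vp : V p := unit_neq0 p1.
  (* The vector w' undoes the inverse matrix in [fixpoint_derive]. It is tangent at pi(p) = h(pi(p))
     Q because Q preserves inner products and D_w h is orthogonal to h. *)
  have Sa := piS _ Vp; pose w' := w *m (1%:M - jac hmap (pi p) *m Qrot p).
  have aw' : dotv (pi p) w' = 0.
    rewrite /w' mulmxBr mulmx1 dotvDr dotvNr aw sub0r mulmxA -derive_hmap_jac//.
    by rewrite {1}(pi_fix _ Vp) (dotv_mulmx_orthogonal _ _ (QQ _ Vp)) hmap_tangent ?oppr0.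
  have pab : qmulr p (pi p) = qmull (hmap (pi p)) p by apply/fixE => //; exact: pi_fix.
  have [u up uw] := Hopf_submersion p1 Sa aw' pab.
  exists u => //.
  rewrite (fixpoint_derive open_hdom sphere_hdom Cs_hmap hmap_sphere mu01 hmu oV CQ QQ piS pi_fix _ Vp (unitN _ Vp)).
  rewrite (_ : entry_derive (@Qrot R) u p = rotM (p + u) - rotM p - rotM u); last first.
    by apply/matrixP => i j; rewrite mxE derive_Qrot.
  by rewrite uw /w' mulmxK//; exact: unitN.
Qed.

End Extension.
End Main.

Theorem mainTheorem8 (R : realType) (g : 'rV[R]_6 -> 'rV[R]_6)
  (g_maps : forall x, S2minus x -> S2plus (g x))
  (g_smooth_decr : exists (U : set 'rV[R]_6) (G : 'rV[R]_6 -> 'rV[R]_6),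
      @S2minus R `<=` U /\ smooth_on G U /\
      (forall x, S2minus x -> G x = g x) /\
      (forall x w, S2minus x -> Eminus w -> dotv w x = 0 -> w != 0 ->
         dotv (derive G x w) (derive G x w) < dotv w w)) :
  (forall x, S2minus x -> simple_unit (x + g x)) /\
  (forall p, S3 p -> exists x, S2minus x /\ plane_mem (x + g x) p /\
      forall y, S2minus y -> plane_mem (y + g y) p -> y = x) /\
  (exists (zeta : 'rV[R]_4 -> 'rV[R]_4) (V : set 'rV[R]_4),
      @S3 R `<=` V /\ smooth_on zeta V /\
      (forall p, S3 p -> forall x, S2minus x -> plane_mem (x + g x) p ->
         dotv (zeta p) (zeta p) = 1 /\ dotv p (zeta p) = 0 /\
         wedge p (zeta p) = x + g x) /\
      (hopf_field zeta <-> exists c, forall x, S2minus x -> g x = c)) /\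
  (exists (pi : 'rV[R]_4 -> 'rV[R]_6) (V : set 'rV[R]_4),
      @S3 R `<=` V /\ smooth_on pi V /\
      (forall p, S3 p -> S2minus (pi p) /\ plane_mem (pi p + g (pi p)) p) /\
      (forall p, S3 p -> forall w, Eminus w -> dotv w (pi p) = 0 ->
         exists u, dotv u p = 0 /\ derive pi p u = w) /\
      (forall x p, S2minus x -> S3 p -> (pi p = x <-> plane_mem (x + g x) p))).
Proof.
have [U [G [S2U [Gsm [Gg Gdecr]]]]] := g_smooth_decr.
have Gmaps x : S2minus x -> S2plus (G x) by move=> Sx; rewrite Gg//; exact: g_maps.
have gE a : sphere a -> g (embm a) = embp (hmap G a).
  by move=> Sa; rewrite (embp_hmap Gmaps)// Gg//; exact/S2minus_embm.
have hS a : sphere a -> sphere (hmap G a) by exact: hmap_sphere.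
have [f [Cf fS fE funi fsub]] := fibration_exists S2U Gsm Gmaps Gdecr.
have planeE p a : dotv p p = 1 -> sphere a ->
    plane_mem (embm a + g (embm a)) p <-> f p = a.
  move=> p1 Sa; rewrite gE// plane_memP//; split; first exact: funi.
  by move=> <-; exact: fE.
have fS3 p : S3 p -> sphere (f p) by move=> p1; apply/fS/unit_neq0.
have S3V : @S3 R `<=` [set p | p != 0] by move=> p; exact: unit_neq0.
have oV := @open_neq0 R 4.
(* A unit p with p a = h(a) p lies on the circle over a, so no fibre is empty; this supplies both an
   orthonormal basis of P(a) and points for testing a Hopf field. *)
have fsurj a : sphere a -> exists2 p, S3 p & f p = a.
  move=> Sa; have [p p1 pab] := exists_intertwiner Sa (hS _ Sa).
  by exists p => //; exact: funi.
split; [|split; [|split]].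
- move=> _ /S2minusP[a Sa ->]; have [p p1 fp] := fsurj _ Sa.
  exists p, (qmulr p a); rewrite gE// -fp; split; last by apply: wedge_unit => //; exact: fE.
  by split => //; rewrite dotv_qmulr_orth dotv_qmulr p1 (fS3 _ p1) mulr1.
- move=> p p1; exists (embm (f p)); split; first exact/S2minus_embm/fS3.
  split; first by apply/planeE => //; exact: fS3.
  by move=> _ /S2minusP[a Sa ->] /(planeE _ _ p1 Sa) ->.
- exists (fun p => qmulr p (f p)), [set p | p != 0]; split => //; split; last split.
  + split => // k; apply/Ck_Cs => // j; apply: Cs_qmulr => // i; exact: Cs_coord.
  + move=> p p1 _ /S2minusP[a Sa ->] /(planeE _ _ p1 Sa) fp.
    rewrite gE// -fp; split; first by rewrite dotv_qmulr p1 (fS3 _ p1) mulr1.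
    by split; [exact: dotv_qmulr_orth|apply: wedge_unit => //; exact: fE].
  split=> [[J [JJT [JJ zJ]]]|[c gc]].
  + have [[a Ja]|[b Jb]] := complex_structure_decomp JJT JJ.
      have fa p : S3 p -> f p = a.
        move=> p1; have := qiml_qmulr p (f p); rewrite (zJ _ p1) Ja qiml_qmulr p1.
        by rewrite !scale1r.
      (* A constant f would have to take both values x and -x, giving (x, -x) = 1 for a unit x. *)
      have [x Sx] := sphere_nonempty R 1.
      have SNx : sphere (- x) by rewrite /sphere /= dotvNl dotvNr opprK.
      have [p p1 px] := fsurj _ Sx; have [q q1 qx] := fsurj _ SNx.
      have : dotv x (- x) = 1 by rewrite -{1}px -qx !fa// -(fa _ p1); exact: fS3.
      by rewrite dotvNr Sx; lra.
    exists (embp b) => _ /S2minusP[a Sa ->]; rewrite gE//.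
    have [p p1 pa] := fsurj _ Sa; congr embp.
    have := qimr_qmull p (hmap G a); rewrite -pa -fE// (zJ _ p1) Jb qimr_qmull p1.
    by rewrite !scale1r.
  + have [x Sx] := sphere_nonempty R 1.
    pose b := hmap G x.
    have hb a : sphere a -> hmap G a = b.
      move=> Sa; rewrite -[LHS](projp_emb 0) -[b](projp_emb 0); congr (projp (_ + _)).
      by rewrite -!gE// !gc//; exact/S2minus_embm.
    exists (lmatrix b); split; last split.
    * by rewrite lmatrix_tr mulNmx lmatrix_sq ?opprK//; exact: hS.
    * by rewrite lmatrix_sq//; exact: hS.
    * by move=> p p1; rewrite mul_lmatrix fE// hb//; exact: fS3.
- have Cpi k j : Cs k (fun p => embm (f p) 0 j) [set p | p != 0].
    apply: (Cs_comp (phi := f) (F := fun a => embm a 0 j) oV openT) => //.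
    by apply: Cs_embm; exact: openT.
  exists (fun p => embm (f p)), [set p | p != 0]; split => //; split; last split; last split.
  + by split => // k; apply/Ck_Cs.
  + move=> p p1; split; first exact/S2minus_embm/fS3.
    by apply/planeE => //; exact: fS3.
  + move=> p p1 w /Eminus_projm ->; rewrite dotv_embm => wf.
    have fw : dotv (f p) (projm w) = 0 by rewrite dotvC; lra.
    have [u up uw] := fsub _ _ p1 fw; exists u; split => //.
    have df : derivable f p u.
      by apply: derivable_rV => j; exact: Cs_derivable (Cf 1%N j) (unit_neq0 p1).
    have [_ D] := derive_comp_vec (phi := f) (F := @embm R) (U := setT) openT
      (fun j => Cs_embm 1 j openT) I df.
    by rewrite [LHS]D derive_additive ?uw//; exact: embmP.
  + move=> _ p /S2minusP[a Sa ->] p1; rewrite planeE//; split=> [E|->//].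
    by rewrite -(projm_emb (f p) 0) E projm_emb.
Qed.
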